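(* Let $\Gamma$ be a finite group, let $\ell$ be a prime number, let $\sigma$ be an automorphism of $\Gamma$ of order $\ell$, and let $V$ be a $\overline{\mathbf{Z}}_\ell[\Gamma\rtimes\langle\sigma\rangle]$-module which is finite free as a $\overline{\mathbf{Z}}_\ell$-module. Suppose that $V\otimes_{\overline{\mathbf{Z}}_\ell}\overline{\mathbf{Q}}_\ell$ is defined over the maximal unramified extension $\mathbf{Q}_\ell^{\mathrm{unr}}$ of $\mathbf{Q}_\ell$ as a $\Gamma$-representation. Then $$T^a(\sigma,V\otimes_{\overline{\mathbf{Z}}_\ell}\overline{\mathbf{F}}_\ell)^{\mathrm{ss}}\ \ge\ \overline U$$ for both $a\in\mathbf{Z}/2$, where $\overline U$ is the semisimple representation of $\Gamma^\sigma$ which is the absolute value of the virtual representation which is the reduction modulo $\ell$ of the $\overline{\mathbf{Q}}_\ell$-representation with character $\gamma\mapsto\mathrm{Tr}(\gamma\rtimes\sigma\mid V\otimes_{\overline{\mathbf{Z}}_\ell}\overline{\mathbf{Q}}_\ell)$.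
   Context: $\Gamma^\sigma$ is the subgroup of $\sigma$-fixed elements of $\Gamma$. For an $\overline{\mathbf{F}}_\ell$-representation $M$ of $\Gamma\rtimes\langle\sigma\rangle$, with $N_\sigma=\sum_{i=0}^{\ell-1}\sigma^i$, the Tate cohomology groups are the $\Gamma^\sigma$-representations $T^0(\sigma,M)=\ker(1-\sigma\mid M)/N_\sigma(M)$ and $T^1(\sigma,M)=\ker(N_\sigma\mid M)/(1-\sigma)M$. The superscript ss denotes semisimplification. For finite-dimensional semisimple representations $A,B$ of a group over a field, $A\le B$ (equivalently $B\ge A$) means that $A$ is isomorphic to a subrepresentation of $B$. If $A=\sum_i n_iA_i$ is a virtual representation with $n_i\in\mathbf{Z}$ and the $A_i$ pairwise non-isomorphic irreducible representations, its absolute value is $|A|=\sum_i|n_i|A_i$.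
   Formalization: The reduction modulo ℓ of the trace function is assumed to be an integral virtual representation; this does not follow from V being defined over Q_ℓ^unr as a Γ-representation (e.g. Γ acting trivially and σ by ζ_ℓ on rank one, ℓ odd), and without it Ū is undefined. *)

(* Defs.v *)
From HB Require Import structures.
From mathcomp Require Import all_boot all_order all_fingroup all_algebra.
From mathcomp Require Import all_solvable all_field all_character.
From mathcomp Require Import boolp.

Set Implicit Arguments.
Unset Strict Implicit.
Unset Printing Implicit Defensive.

Import GroupScope GRing.Theory.
Local Open Scope ring_scope.

(* The ring Z_l of l-adic integers as the inverse limit of the rings Z/l^n:   *)
(* the n-th term is the canonical representative, in [0, l^n[, of the residue *)
(* class modulo l^n. The primality proof is a parameter of the type because   *)
(* the integral domain structure needs it.                                    *)

Fact modz_dvdm (a d m : int) : (d %| m)%Z -> ((a %% m)%Z %% d)%Z = (a %% d)%Z.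
Proof. by case/dvdzP=> q ->; rewrite {2}(divz_eq a (q * d)) mulrA modzMDl. Qed.

Definition coherent (l : nat) (x : nat -> int) : bool :=
  `[< forall n, x n = (x n.+1 %% (l ^ n)%N%:Z)%Z >].

Record padic_int (l : nat) (l_pr : prime l) := PadicInt {
  padic_seq :> nat -> int;
  padic_coherent : coherent l padic_seq }.

Section PadicIntegers.

Variables (l : nat) (l_pr : prime l).
Local Notation Zl := (padic_int l_pr).

HB.instance Definition _ := [isSub for @padic_seq l l_pr].
HB.instance Definition _ := [Choice of Zl by <:].

Fact padic_seqE (x : Zl) n : x n = (x n.+1 %% (l ^ n)%N%:Z)%Z.
Proof. by have /asboolP := padic_coherent x. Qed.

Fact padic_mod (x : Zl) n : (x n %% (l ^ n)%N%:Z)%Z = x n.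
Proof. by rewrite (padic_seqE x n) modz_mod. Qed.

Fact coherent_reduce (y : nat -> int) :
  (forall n, y n = y n.+1 %[mod (l ^ n)%N%:Z])%Z ->
  coherent l (fun n => (y n %% (l ^ n)%N%:Z)%Z).
Proof.
move=> yE; apply/asboolP => n.
by rewrite modz_dvdm ?yE // dvdzE /= dvdn_exp2l.
Qed.

Definition reduce_seq y yE := PadicInt l_pr (@coherent_reduce y yE).

Fact padic_nextE (x : Zl) n : (x n = x n.+1 %[mod (l ^ n)%N%:Z])%Z.
Proof. by rewrite padic_mod padic_seqE. Qed.

Fact padic_cst_subproof (a : int) n : (a = a %[mod (l ^ n)%N%:Z])%Z.
Proof. by []. Qed.

Fact padic_add_subproof (x y : Zl) n :
  (x n + y n = x n.+1 + y n.+1 %[mod (l ^ n)%N%:Z])%Z.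
Proof.
by rewrite -modzDml padic_nextE modzDml -modzDmr padic_nextE modzDmr.
Qed.

Fact padic_opp_subproof (x : Zl) n :
  (- x n = - x n.+1 %[mod (l ^ n)%N%:Z])%Z.
Proof. by rewrite -modzNm padic_nextE modzNm. Qed.

Fact padic_mul_subproof (x y : Zl) n :
  (x n * y n = x n.+1 * y n.+1 %[mod (l ^ n)%N%:Z])%Z.
Proof.
by rewrite -modzMml padic_nextE modzMml -modzMmr padic_nextE modzMmr.
Qed.

Definition padic_cst a := reduce_seq (padic_cst_subproof a).
Definition padic_add x y := reduce_seq (padic_add_subproof x y).
Definition padic_opp x := reduce_seq (padic_opp_subproof x).
Definition padic_mul x y := reduce_seq (padic_mul_subproof x y).

Fact padicP (x y : Zl) : (forall n, x n = y n) -> x = y.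
Proof. by move=> xy; apply: val_inj; apply: funext. Qed.

Fact padic_addA : associative padic_add.
Proof. by move=> x y z; apply: padicP => n /=; rewrite modzDml modzDmr addrA. Qed.
Fact padic_addC : commutative padic_add.
Proof. by move=> x y; apply: padicP => n /=; rewrite addrC. Qed.
Fact padic_add0 : left_id (padic_cst 0) padic_add.
Proof. by move=> x; apply: padicP => n /=; rewrite modzDml add0r padic_mod. Qed.
Fact padic_addN : left_inverse (padic_cst 0) padic_opp padic_add.
Proof. by move=> x; apply: padicP => n /=; rewrite modzDml addNr. Qed.

HB.instance Definition _ := GRing.isZmodule.Build Zl
  padic_addA padic_addC padic_add0 padic_addN.

Fact padic_mulA : associative padic_mul.
Proof. by move=> x y z; apply: padicP => n /=; rewrite modzMml modzMmr mulrA. Qed.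
Fact padic_mulC : commutative padic_mul.
Proof. by move=> x y; apply: padicP => n /=; rewrite mulrC. Qed.
Fact padic_mul1 : left_id (padic_cst 1) padic_mul.
Proof. by move=> x; apply: padicP => n /=; rewrite modzMml mul1r padic_mod. Qed.
Fact padic_mulD : left_distributive padic_mul +%R.
Proof.
move=> x y z; apply: padicP => n /=.
by rewrite modzMml modzDml modzDmr mulrDl.
Qed.
Fact padic_1n0 : padic_cst 1 != 0.
Proof.
apply/eqP => /(congr1 (fun x : Zl => x 1)) /=.
by rewrite expn1 mod0z modz_small //= ltz_nat prime_gt1.
Qed.

HB.instance Definition _ := GRing.Zmodule_isComNzRing.Build Zl
  padic_mulA padic_mulC padic_mul1 padic_mulD padic_1n0.

Definition padic_unit : {pred Zl} :=
  fun x => `[< exists y : Zl, y * x = 1 >].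
Definition padic_inv (x : Zl) : Zl :=
  if pselect (exists y : Zl, y * x = 1) is left ex then projT1 (cid ex)
  else x.

Fact padic_mulVx : {in padic_unit, left_inverse 1 padic_inv *%R}.
Proof.
by move=> x /asboolP ex; rewrite /padic_inv; case: pselect => // ?; case: cid.
Qed.
Fact padic_unitPl (x y : Zl) : y * x = 1 -> padic_unit x.
Proof. by move=> yx; apply/asboolP; exists y. Qed.
Fact padic_inv_out : {in [predC padic_unit], padic_inv =1 id}.
Proof.
move=> x /negP nx; rewrite /padic_inv; case: pselect => // ex.
by case: nx; apply/asboolP.
Qed.

HB.instance Definition _ := GRing.ComNzRing_hasMulInverse.Build Zl
  padic_mulVx padic_unitPl padic_inv_out.

(* A nonzero x has a nonzero term; all later terms have bounded valuation. *)
Fact padic_neq0 (x : Zl) : x != 0 ->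
  exists n, forall m, (n <= m)%N -> ~~ ((l ^ n)%N%:Z %| x m)%Z.
Proof.
move=> /eqP xn0; have [n xn] : exists n, x n <> 0.
  apply: contrapT => x0; apply: xn0; apply: padicP => n.
  by rewrite /= mod0z; apply: contrapT => xn; apply: x0; exists n.
have xE m : x (n + m)%N = x n %[mod (l ^ n)%N%:Z]%Z.
  elim: m => [|m IHm]; first by rewrite addn0.
  rewrite -IHm addnS [x (n + m)%N]padic_seqE modz_dvdm //.
  by rewrite dvdzE /= dvdn_exp2l ?leq_addr.
exists n => m /subnKC <-; apply/negP => /dvdz_mod0P.
by rewrite xE padic_mod.
Qed.

Fact padic_mulf_eq0 (x y : Zl) : x * y = 0 -> (x == 0) || (y == 0).
Proof.
move=> xy0; apply: contraT; rewrite negb_or.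
move=> /andP[/padic_neq0[a xa] /padic_neq0[b yb]].
have := congr1 (fun z : Zl => z (a + b)%N) xy0.
rewrite /= mod0z => /dvdz_mod0P.
have {xa} := xa _ (leq_addr b a); have {yb} := yb _ (leq_addl a b).
rewrite !dvdzE /= abszM.
move: (absz _) (absz _) => u v nv nu.
have v0 : (0 < v)%N by case: v nu nv => [|v] //; rewrite dvdn0.
have u0 : (0 < u)%N by case: u nv nu => [|u] //; rewrite dvdn0.
move: nv nu; rewrite !pfactor_dvdn ?muln_gt0 ?u0 ?v0 // lognM // -!ltnNge.
by move=> nb na; rewrite leqNgt (leq_add na (ltnW nb)).
Qed.

HB.instance Definition _ := GRing.ComUnitRing_isIntegral.Build Zl
  padic_mulf_eq0.

End PadicIntegers.

Definition Ql (l : nat) (l_pr : prime l) : fieldType :=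
  {fraction padic_int l_pr}.

(* Below, [incl] is the structure map of an algebraic closure K of Q_l.       *)

Section IntegralClosure.

Variables (l : nat) (l_pr : prime l) (K : fieldType).
Variable incl : {rmorphism Ql l_pr -> K}.

Definition Zl_to_K : padic_int l_pr -> K := incl \o @tofrac (padic_int l_pr).
HB.instance Definition _ := GRing.RMorphism.on Zl_to_K.

Definition in_Zlbar : {pred K} := fun x => `[< integralOver Zl_to_K x >].

Record Zlbar := InZlbar { Zlbar_val :> K; Zlbar_valP : Zlbar_val \in in_Zlbar }.

HB.instance Definition _ := [isSub for Zlbar_val].
HB.instance Definition _ := [Choice of Zlbar by <:].

Fact in_Zlbar_subring : subring_closed in_Zlbar.
Proof.
split=> [|x y /asboolP ix /asboolP iy|x y /asboolP ix /asboolP iy].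
- by apply/asboolP; apply: integral1.
- by apply/asboolP; apply: integral_sub.
- by apply/asboolP; apply: integral_mul.
Qed.

HB.instance Definition _ :=
  GRing.SubChoice_isSubComNzRing.Build K in_Zlbar Zlbar in_Zlbar_subring.

Definition Zlbar_unit : {pred Zlbar} :=
  fun x => (val x != 0) && ((val x)^-1 \in in_Zlbar).
Definition Zlbar_inv (x : Zlbar) : Zlbar := insubd x (val x)^-1.

Fact Zlbar_mulVx : {in Zlbar_unit, left_inverse 1 Zlbar_inv *%R}.
Proof.
move=> x /andP[x0 Vx]; apply: val_inj.
by rewrite rmorphM rmorph1 /= val_insubd Vx mulVf.
Qed.
Fact Zlbar_unitPl (x y : Zlbar) : y * x = 1 -> Zlbar_unit x.
Proof.
move=> /(congr1 val) yx; have {}yx : val y * val x = 1 by [].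
have x0 : val x != 0.
  by apply/eqP => x0; move: yx; rewrite x0 mulr0 => /esym/eqP; rewrite oner_eq0.
rewrite /Zlbar_unit x0 /=; suff -> : (val x)^-1 = val y by apply: valP.
by apply: (mulIf x0); rewrite mulVf.
Qed.
Fact Zlbar_inv_out : {in [predC Zlbar_unit], Zlbar_inv =1 id}.
Proof.
move=> x; rewrite inE /= => nUx; apply: val_inj; rewrite val_insubd.
case: ifP => // Vx; move: nUx; rewrite unfold_in Vx andbT negbK => /eqP x0.
by rewrite x0 invr0.
Qed.

HB.instance Definition _ := GRing.ComNzRing_hasMulInverse.Build Zlbar
  Zlbar_mulVx Zlbar_unitPl Zlbar_inv_out.

Definition finite_subextension (L : {pred K}) : Prop :=
  divring_closed L /\
  exists (d : nat) (e : 'I_d -> K), forall x,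
    x \in L <-> exists c : 'I_d -> Ql l_pr, x = \sum_i incl (c i) * e i.

(* The valuation ring of L is the intersection of L with the integral closure *)
(* of Z_l, and L is unramified when l generates its maximal ideal; residue    *)
(* extensions are automatically separable since F_l is perfect. Note that     *)
(* x = 0 is not excluded by the first premise but satisfies the conclusion.   *)
Definition unramified (L : {pred K}) : Prop :=
  forall x, x \in L -> x \in in_Zlbar ->
    ~ (x != 0 /\ x^-1 \in in_Zlbar) -> x / l%:R \in in_Zlbar.

(* The maximal unramified extension: union of all finite unramified ones. *)
Definition Qlunr : {pred K} := fun x =>
  `[< exists L, [/\ finite_subextension L, unramified L & x \in L] >].

End IntegralClosure.

Section Representations.

Variables (F : fieldType) (gT : finGroupType) (G : {group gT}).

Definition defined_over (S : {pred F}) n (rG : mx_representation F G n) : Prop :=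
  exists rS : mx_representation F G n,
    mx_rsim rG rS /\ {in G, forall g, rS g \is a mxOver S}.

Definition isom_subrep n1 (rA : mx_representation F G n1)
    n2 (rB : mx_representation F G n2) : Prop :=
  exists (U : 'M_n2) (modU : mxmodule rB U), mx_rsim rA (submod_repr modU).

Variables (n : nat) (rG : mx_representation F G n).

Fact full_series_exists :
  exists U, mx_composition_series rG U /\ (last 0 U :=: 1%:M)%MS.
Proof.
apply/asboolP; apply: (@mx_Schreier F gT G n rG [::]) => // -[U [cU lU _]].
by apply/asboolP; exists U.
Qed.

Definition full_series : seq 'M[F]_n := projT1 (cid full_series_exists).
Fact full_seriesP : mx_composition_series rG full_series.
Proof. by rewrite /full_series; case: cid => U []. Qed.

(* The choice of series does not matter, by the Jordan-Hoelder theorem. *)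
Definition composition_factors : seq (representation F G) :=
  [seq Representation (series_repr i full_seriesP) | i <- iota 0 (size full_series)].

Definition semisimplification : representation F G :=
  \big[@dadd_grepr F gT G/@grepr0 F gT G]_(S <- composition_factors) S.

Definition composition_mult (S : representation F G) : nat :=
  count (fun S' : representation F G => `[< mx_rsim S' S >]) composition_factors.

End Representations.

Section SemidirectProduct.

Variables (gT : finGroupType) (G : {group gT}).
Variables (s : {perm gT}) (As : s \in Aut G).

Fact cycle_sub_Aut : <[s]>%g \subset Aut G.
Proof. by rewrite cycle_subG. Qed.

Definition sd_act : groupAction <[s]> G := ([Aut G] \ cycle_sub_Aut)%gact.
Definition semidirect : finGroupType := sdprod_by sd_act.

(* The element written g x| s^i, for g \in G. *)
Definition sd_elt (g : gT) (i : nat) : semidirect :=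
  (sdpair1 sd_act g * sdpair2 sd_act (s ^+ i))%g.

Definition fixed_subgroup : {group gT} := 'C_(G | [Aut G])[s]%G.

Section Restriction.

Variables (R : comUnitRingType) (n : nat).
Variable rM : mx_representation R [set: semidirect] n.

Fact res_G_subproof : G \subset (sdpair1 sd_act @*^-1 [set: semidirect])%g.
Proof. by apply/subsetP => x Gx; rewrite !inE Gx. Qed.

Definition res_G : mx_representation R G n :=
  subg_repr (morphpre_repr (sdpair1_morphism sd_act) rM) res_G_subproof.

Definition res_fixed : mx_representation R fixed_subgroup n :=
  subg_repr res_G (subsetIl G _).

End Restriction.

(* Matrices act on row vectors from the right (left modules are recovered by  *)
(* passing to the opposite group), so that the kernel and the image of an     *)
(* endomorphism are the row spaces of [kermx f] and of [f].                   *)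
Section Tate.

Variables (F : fieldType) (n : nat).
Variable rM : mx_representation F [set: semidirect] n.

Definition sigma_mx : 'M[F]_n := rM (sd_elt 1 1).
Definition one_minus_sigma : 'M[F]_n := 1%:M - sigma_mx.
Definition norm_sigma : 'M[F]_n := \sum_(i < #[s]%g) rM (sd_elt 1 i).

Fact sd_elt_fixed_comm x i : x \in fixed_subgroup ->
  rM (sd_elt 1 i) *m res_fixed rM x = res_fixed rM x *m rM (sd_elt 1 i).
Proof.
move=> Cx; have [Gx fx] : x \in G /\ s x = x.
  move: Cx; rewrite !inE => /and3P[Gx _ /subsetP/(_ s)].
  by rewrite in_setI As set11 inE => /(_ isT)/eqP sx; split.
have -> : res_fixed rM x = rM (sdpair1 sd_act x) by [].
rewrite -!repr_mxM ?in_setT //; congr (rM _).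
rewrite /sd_elt morph1 mul1g.
have si : (s ^+ i)%g \in <[s]>%g by rewrite mem_cycle.
have fxi : (sd_act x (s ^+ i)%g = x)%g.
  rewrite /= /autact /= /aperm.
  elim: i {si} => [|i IHi]; first by rewrite expg0 perm1.
  by rewrite expgSr permM IHi.
by rewrite [RHS]conjgC -sdpair_act // fxi.
Qed.

Fact one_minus_sigma_cent : centgmx (res_fixed rM) one_minus_sigma.
Proof.
apply/centgmxP => x Cx.
by rewrite mulmxBl mulmxBr mul1mx mulmx1 sd_elt_fixed_comm.
Qed.

Fact norm_sigma_cent : centgmx (res_fixed rM) norm_sigma.
Proof.
apply/centgmxP => x Cx; rewrite mulmx_suml mulmx_sumr.
by apply: eq_bigr => i _; rewrite sd_elt_fixed_comm.
Qed.

Fact image_module f : centgmx (res_fixed rM) f -> mxmodule (res_fixed rM) f.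
Proof.
move=> /centgmxP cf; apply/mxmoduleP => x Cx.
by rewrite cf // submxMl.
Qed.

Definition Tate0 := section_repr (image_module norm_sigma_cent)
                      (kermx_centg_module one_minus_sigma_cent).
Definition Tate1 := section_repr (image_module one_minus_sigma_cent)
                      (kermx_centg_module norm_sigma_cent).

Definition Tate (a : 'Z_2) : representation F fixed_subgroup :=
  if a == 0 then Representation Tate0 else Representation Tate1.

End Tate.

End SemidirectProduct.

(* Reduction modulo l of virtual representations of a finite group H. The     *)
(* reduction of the representation on L (x) K, for L a finite free Zlbar[H]-  *)
(* module, is the class of L (x) k in the Grothendieck group, extended here   *)
(* linearly to combinations of characters with coefficients in K: a function  *)
(* such as g |-> Tr(g x| s) is in general a combination of characters whose   *)
(* coefficients lie in Z[zeta_l], whereas its reduction can be integral.      *)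
(* [reduces_to phi A m] says that the reduction of the virtual representation *)
(* with character phi is \sum_i m_i A_i.                                      *)
Section Reduction.

Variables (l : nat) (l_pr : prime l) (K : fieldType).
Variables (incl : {rmorphism Ql l_pr -> K}) (k : fieldType).
Variable red : {rmorphism Zlbar incl -> k}.
Variables (hT : finGroupType) (H : {group hT}).

Definition reduces_to (phi : hT -> K)
    (I : finType) (A : I -> representation k H) (m : I -> int) : Prop :=
  exists (d : nat) (c : 'I_d -> K) (r : 'I_d -> nat)
         (L : forall j, mx_representation (Zlbar incl) H (r j)),
    {in H, forall h, phi h = \sum_j c j * \tr (map_repr val (L j) h)} /\
    forall S : representation k H, mx_irreducible S ->
      \sum_j c j * (composition_mult (map_repr red (L j)) S)%:R
        = \sum_(i | `[< mx_rsim (A i) S >]) (m i)%:~R.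

End Reduction.

(* |\sum_i m_i A_i|, for pairwise non-isomorphic irreducible A_i. *)
Definition virtual_abs (F : fieldType) (gT : finGroupType) (G : {group gT})
    (I : finType) (A : I -> representation F G) (m : I -> int) :
    representation F G :=
  \big[@dadd_grepr F gT G/@grepr0 F gT G]_i muln_grepr (A i) `|m i|%N.

(* Main.v *)
Require Import Defs.
From mathcomp Require Import all_boot all_order all_fingroup all_algebra.
From mathcomp Require Import all_solvable all_field all_character.
From mathcomp Require Import boolp zify.

Set Implicit Arguments.
Unset Strict Implicit.
Unset Printing Implicit Defensive.

Import GRing.Theory.
Local Open Scope ring_scope.

(* Let H be the group of s-fixed elements, O, K, k the rings Zlbar, Qlbar,    *)
(* Flbar, and S an irreducible k[H]-module. By density some e in k[H] acts on *)
(* every H-module of bounded dimension as an idempotent whose rank is the     *)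
(* multiplicity of S. If a in O[H] lifts e, the eigenvalues of a on O[H]-     *)
(* lattices lie in O and reduce to 0 or 1; killing those that reduce to 0     *)
(* gives b in O[H] that still lifts e and whose image on each lattice is,     *)
(* over K, that of an idempotent f in K[H]. Since ranks cannot increase under *)
(* reduction, for b as well as for the complementary lift of 1 - e, the trace *)
(* of f on a lattice L is the multiplicity of S in L (x) k. Hence the         *)
(* multiplicity m of S in the reduction of the virtual representation is the  *)
(* trace of f sigma on V, i.e., m = \sum_j n_j zeta^-j where n_j is the       *)
(* dimension of the zeta^-j-eigenspace of sigma on f V_K; as m is an integer, *)
(* irreducibility of the l-th cyclotomic polynomial gives m = n_0 - n_1.      *)
(* Finally the multiplicity of S in either Tate group is                      *)
(*   rank e - rank e(1 - sigma) - rank eN  on V (x) k,                        *)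
(* and since 1 - sigma and N are also the reductions of 1 - zeta^i sigma and  *)
(* N_j = \sum_i zeta^ij sigma^i, this is at least n_i - n_j for all i and j.  *)

(** * Elements of the group algebra acting on representations *)

(** Containment between semisimple modules is a comparison of multiplicities ([embeds_sum_muln]), so
    the irreducible S can be fixed. Multiplicities of S are then ranks of one idempotent e of the
    group algebra ([mult_idempotent]), and ranks of e are additive on subquotients. For either Tate
    group this yields a lower bound by rank e - rank e(1 - sigma) - rank eN ([Tate_lower_bound]). It
    remains to bound this difference below by |m|, which is [tate_bound]. As zeta reduces to 1, all
    twists zeta^j sigma have the same reduction; hence, for every j, rank eN <= n_j and rank e(1 -
    sigma) <= rank e - n_j. Taking the smaller of n_0, n_1 in the first bound and the larger in the
    second leaves a gap |n_0 - n_1|, equal to |m| by [prim_root_integer_sum]. The trace that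
    determines m can be computed because [lift_idempotent] lifts e on V and on all lattices of the
    character identity at once. *)

Section GroupAlgebraAction.

Variables (R : comUnitRingType) (gT : finGroupType) (G : {group gT}).
Local Notation reprG := (mx_representation R G).
Implicit Types c d : gT -> R.

Definition gact c n (rG : reprG n) : 'M[R]_n := \sum_(x in G) c x *: rG x.

(** The witness is the convolution product. It is chosen before the representation: throughout, one
    element of the group algebra has to serve all representations. *)
Lemma gactM c d :
  exists e, forall n (rG : reprG n), gact e rG = gact c rG *m gact d rG.
Proof.
exists (fun z => \sum_(x in G) c x * d (x^-1 * z)%g) => n rG.
rewrite /gact mulmx_suml.
under eq_bigr do rewrite scaler_suml.
rewrite exchange_big /=; apply: eq_bigr => x Gx.
rewrite mulmx_sumr (reindex_inj (mulgI x)) /=.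
rewrite (eq_bigl (mem G)) => [|y]; last by rewrite groupMl.
apply: eq_bigr => y Gy.
by rewrite mulKg repr_mxM // -scalemxAl -scalemxAr scalerA.
Qed.

Lemma gactD c d n (rG : reprG n) :
  gact (fun x => c x + d x) rG = gact c rG + gact d rG.
Proof. by rewrite /gact -big_split /=; apply: eq_bigr => x _; rewrite scalerDl. Qed.

Lemma gactZ a c n (rG : reprG n) : gact (fun x => a * c x) rG = a *: gact c rG.
Proof. by rewrite /gact scaler_sumr; apply: eq_bigr => x _; rewrite scalerA. Qed.

Lemma gact_delta g n (rG : reprG n) :
  g \in G -> gact (fun x => (x == g)%:R) rG = rG g.
Proof.
move=> Gg; rewrite /gact (bigD1 g) //= eqxx scale1r big1 ?addr0 // => x.
by case/andP=> _ /negPf->; rewrite scale0r.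
Qed.

Lemma gact1 n (rG : reprG n) : gact (fun x => (x == 1%g)%:R) rG = 1%:M.
Proof. by rewrite gact_delta // repr_mx1. Qed.

Lemma gact0 n (rG : reprG n) : gact (fun=> 0) rG = 0.
Proof. by rewrite /gact big1 // => x _; rewrite scale0r. Qed.

Lemma gact_horner c (q : {poly R}) :
  exists e, forall n (rG : reprG n.+1), gact e rG = horner_mx (gact c rG) q.
Proof.
elim/poly_ind: q => [|q a [e IHq]].
  by exists (fun=> 0) => n rG; rewrite gact0 rmorph0.
have [e' De'] := gactM e c.
exists (fun x => e' x + a * (x == 1%g)%:R) => n rG.
by rewrite gactD gactZ gact1 De' rmorphD rmorphM /= horner_mx_X horner_mx_C IHq
           scalemx1.
Qed.

Lemma gact_sum (I : Type) (r : seq I) (P : pred I) (c : I -> gT -> R) n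
    (rG : reprG n) :
  gact (fun x => \sum_(i <- r | P i) c i x) rG = \sum_(i <- r | P i) gact (c i) rG.
Proof. by rewrite /gact exchange_big; apply: eq_bigr => x _; rewrite scaler_suml. Qed.

Lemma gact_commr c n (rG : reprG n) (A : 'M_n) :
  (forall x, x \in G -> A *m rG x = rG x *m A) ->
  A *m gact c rG = gact c rG *m A.
Proof.
move=> cA; rewrite mulmx_sumr mulmx_suml; apply: eq_bigr => x Gx.
by rewrite -scalemxAr cA // scalemxAl.
Qed.

Lemma gact_trace c n (rG : reprG n) (A : 'M_n) :
  \tr (gact c rG *m A) = \sum_(x in G) c x * \tr (rG x *m A).
Proof.
rewrite mulmx_suml raddf_sum /=; apply: eq_bigr => x _.
by rewrite -scalemxAl mxtraceZ.
Qed.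

End GroupAlgebraAction.

Lemma map_gact (R S : comUnitRingType) (f : {rmorphism R -> S})
    (gT : finGroupType) (G : {group gT}) c n (rG : mx_representation R G n) :
  map_mx f (gact c rG) = gact (f \o c) (map_repr f rG).
Proof. by rewrite raddf_sum /=; apply: eq_bigr => x _; rewrite map_mxZ. Qed.

Section FieldAction.

Variables (F : fieldType) (gT : finGroupType) (G : {group gT}).
Local Notation reprG := (mx_representation F G).
Implicit Types c : gT -> F.

Lemma gact_hom c n1 n2 (r1 : reprG n1) (r2 : reprG n2) (B : 'M_(n1, n2)) :
  (forall x, x \in G -> r1 x *m B = B *m r2 x) -> gact c r1 *m B = B *m gact c r2.
Proof.
move=> hB; rewrite mulmx_suml mulmx_sumr; apply: eq_bigr => x Gx.
by rewrite -scalemxAl hB // scalemxAr.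
Qed.

Lemma mxrank_gact_rsim c n1 n2 (r1 : reprG n1) (r2 : reprG n2) :
  mx_rsim r1 r2 -> \rank (gact c r1) = \rank (gact c r2).
Proof.
case=> B en; case: _ / en in B r2 * => freeB hB.
have fullB : row_full B by rewrite row_full_unit -row_free_unit.
by rewrite -(mxrankMfree _ freeB) (gact_hom c hB) (eqmxMfull _ fullB).
Qed.

Lemma gact_rsim_eq0 c n1 n2 (r1 : reprG n1) (r2 : reprG n2) :
  mx_rsim r1 r2 -> gact c r1 = 0 -> gact c r2 = 0.
Proof.
move=> /(mxrank_gact_rsim c) eqr r10.
by apply/eqP; rewrite -mxrank_eq0 -eqr r10 mxrank0.
Qed.

Lemma gact_mxmodule c n (rG : reprG n) m (U : 'M_(m, n)) :
  mxmodule rG U -> (U *m gact c rG <= U)%MS.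
Proof.
move=> /mxmoduleP modU; rewrite mulmx_sumr summx_sub // => x Gx.
by rewrite -scalemxAr scalemx_sub ?modU.
Qed.

Lemma mxrank_gact_submod c n (rG : reprG n) (U : 'M_n) (modU : mxmodule rG U) :
  \rank (gact c (submod_repr modU)) = \rank (U *m gact c rG).
Proof.
rewrite -(eqmxMr _ (val_submod1 U)) -[gact c _]mul1mx.
rewrite -(mxrankMfree _ (row_base_free U)).
congr (\rank _); rewrite -[LHS]/(val_submod _) !mulmx_sumr linear_sum /=.
apply: eq_bigr => x Gx.
by rewrite -!scalemxAr linearZ /= -val_submodJ.
Qed.

(** The section is the image of [W] in the quotient by [U], so [c] acts on it with image that of
    [W *m gact c rG]; what is lost is the part of that image lying in [U]. *)
Lemma mxrank_gact_section c n (rG : reprG n) (U W : 'M_n)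
    (modU : mxmodule rG U) (modW : mxmodule rG W) :
  (\rank (gact c (section_repr modU modW)) + \rank (W *m gact c rG :&: U)
    = \rank (W *m gact c rG))%N.
Proof.
rewrite mxrank_gact_submod (eqmxMr _ (genmxE _)).
have -> : in_factmod U W *m gact c (factmod_repr modU)
          = in_factmod U (W *m gact c rG).
  rewrite !mulmx_sumr linear_sum /=; apply: eq_bigr => x Gx.
  by rewrite -!scalemxAr linearZ /= in_factmodJ.
rewrite -[RHS](mxrank_mul_ker _ (in_factmod U 1%:M)) -in_factmodE.
congr addn; suff e : (U :=: kermx (in_factmod U 1%:M))%MS.
  by rewrite (cap_eqmx (eqmx_refl _) e).
apply/eqmxP/rV_eqP => u.
by rewrite (sameP sub_kermxP eqP) -in_factmodE in_factmod_eq0.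
Qed.

Lemma submx_idem n m (A : 'M[F]_n) (C : 'M_(m, n)) :
  A *m A = A -> (C <= A)%MS -> C *m A = C.
Proof. by move=> idA /submxP[D ->]; rewrite -mulmxA idA. Qed.

(** An idempotent fixes its image pointwise, so the part of the image lying in [U] already lies in
    the image of [U]. *)
Lemma mxrank_gact_section_lower c n (rG : reprG n) (U W : 'M_n)
    (modU : mxmodule rG U) (modW : mxmodule rG W) :
  gact c rG *m gact c rG = gact c rG ->
  (\rank (W *m gact c rG) <= \rank (gact c (section_repr modU modW))
                              + \rank (U *m gact c rG))%N.
Proof.
move=> idc; rewrite -(mxrank_gact_section c modU modW) leq_add2l; apply: mxrankS.
set A := (_ :&: _)%MS; have <- : A *m gact c rG = A.
  apply: submx_idem idc _; exact: submx_trans (capmxSl _ _) (submxMl _ _).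
exact/submxMr/capmxSr.
Qed.

Lemma mxrank_gact_section_idem c n (rG : reprG n) (U W : 'M_n)
    (modU : mxmodule rG U) (modW : mxmodule rG W) :
  (U <= W)%MS -> gact c rG *m gact c rG = gact c rG ->
  (\rank (gact c (section_repr modU modW)) + \rank (U *m gact c rG)
    = \rank (W *m gact c rG))%N.
Proof.
move=> sUW idc; apply/eqP; rewrite eqn_leq mxrank_gact_section_lower // andbT.
rewrite -(mxrank_gact_section c modU modW) leq_add2l mxrankS //.
by rewrite sub_capmx submxMr ?gact_mxmodule.
Qed.

Lemma gact_section_eq0 c n (rG : reprG n) (U W : 'M_n)
    (modU : mxmodule rG U) (modW : mxmodule rG W) :
  gact c (section_repr modU modW) = 0 -> (W *m gact c rG <= U)%MS.
Proof.
move=> c0; have := mxrank_gact_section c modU modW; rewrite c0 mxrank0 add0n.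
move=> eqr; apply: submx_trans (capmxSr (W *m gact c rG)%MS U).
by rewrite -(geq_leqif (mxrank_leqif_sup (capmxSl _ _))) eqr.
Qed.

End FieldAction.

(** Schur's lemma: kernel and image of [f] are submodules. *)
Lemma mx_rsim_irr_hom (F : fieldType) (gT : finGroupType) (G : {group gT})
    n1 n2 (r1 : mx_representation F G n1) (r2 : mx_representation F G n2)
    (f : 'M_(n1, n2)) :
  mx_irreducible r1 -> mx_irreducible r2 ->
  (forall x, x \in G -> r1 x *m f = f *m r2 x) -> f != 0 -> mx_rsim r1 r2.
Proof.
move=> /mx_irrP[_ irr1] /mx_irrP[_ irr2] hf nzf.
have freef : row_free f.
  rewrite -kermx_eq0; apply: contraT => nzk; case/negP: nzf; apply/eqP.
  have /irr1/(_ nzk)/row_fullP[B Bk] : mxmodule r1 (kermx f).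
    apply/mxmoduleP => x Gx; apply/sub_kermxP.
    by rewrite -mulmxA hf // mulmxA mulmx_ker mul0mx.
  by rewrite -[f]mul1mx -Bk -mulmxA mulmx_ker mulmx0.
have fullf : row_full f.
  rewrite /row_full -(genmxE f) -[_ == _]/(row_full _); apply: irr2.
    rewrite (eqmx_module _ (genmxE f)); apply/mxmoduleP => x Gx.
    by rewrite -hf // submxMl.
  by rewrite -mxrank_eq0 genmxE mxrank_eq0.
have en : n1 = n2 by rewrite -(eqP freef) (eqP fullf).
by exists f.
Qed.

(** * Density: elements of the group algebra isolating an irreducible module *)

Section Density.

Variables (F : closedFieldType) (gT : finGroupType) (G : {group gT}).
Local Notation reprG := (mx_representation F G).
Implicit Types c : gT -> F.

(** Burnside's theorem: over a closed field an irreducible representation is absolutely irreducible,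
    so its enveloping algebra is the full matrix algebra. *)
Lemma gact_onto n (rG : reprG n) (A : 'M_n) :
  mx_irreducible rG -> exists c, gact c rG = A.
Proof.
move=> /(@group_closure_closed_field F gT G n)/mx_abs_irrP[_ [a aE]].
by exists (a^~ A); rewrite /gact -aE.
Qed.

(** If every element killing [r2] killed [r1], the action on [r1] would factor through the matrix
    algebra of [r2], which produces a non-zero homomorphism from [r2] to [r1] and so an isomorphism.
    Hence the annihilator of [r2] acts on [r1] through a non-zero two-sided ideal of a full matrix
    algebra, which contains the identity. *)
Lemma gact_separate n1 n2 (r1 : reprG n1) (r2 : reprG n2) :
  mx_irreducible r1 -> mx_irreducible r2 -> ~ mx_rsim r2 r1 ->
  exists2 c, gact c r1 = 1%:M & gact c r2 = 0.
Proof.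
move=> irr1 irr2 nsim.
have [c c0 [p [q nz_c]]] :
    exists2 c, gact c r2 = 0 & exists p q, gact c r1 p q != 0.
  apply: contrapT => noc; apply: nsim.
  have ann c : gact c r2 = 0 -> gact c r1 = 0.
    move=> c0; apply/matrixP => p q; rewrite [RHS]mxE; apply/eqP.
    by apply: contraT => nz; case: noc; exists c => //; exists p, q.
  have ann_eq c c' : gact c r2 = gact c' r2 -> gact c r1 = gact c' r1.
    move=> ecc'; apply/eqP; rewrite -subr_eq0; apply/eqP.
    rewrite -scaleN1r -gactZ -gactD; apply: ann.
    by rewrite gactD gactZ scaleN1r ecc' subrr.
  have /choice[d dE] : forall ij : 'I_n2 * 'I_n2,
      exists c, gact c r2 = delta_mx ij.1 ij.2.
    by move=> ij; apply: gact_onto.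
  (* The [d (i, i)] sum to the identity on [r2], hence on [r1] by [ann_eq], so they cannot all
     vanish there. *)
  have [i nz_i] : exists i, gact (d (i, i)) r1 != 0.
    apply: contrapT => no_i; have /mx_irrP[n1_gt0 _] := irr1.
    have : gact (fun x => \sum_i d (i, i) x) r1 = 1%:M.
      rewrite -(gact1 r1); apply: ann_eq.
      rewrite gact_sum gact1 [RHS]mx1_sum_delta.
      by apply: eq_bigr => i _; rewrite dE.
    rewrite gact_sum big1 => [|i _]; last first.
      by apply/eqP; apply: contraT => nz; case: no_i; exists i.
    move/matrixP/(_ (Ordinal n1_gt0) (Ordinal n1_gt0))/eqP.
    by rewrite !mxE eqxx eq_sym oner_eq0.
  have [w nz_w] : exists w, row w (gact (d (i, i)) r1) != 0.
    apply/existsP; apply: contraNT nz_i => /existsPn no_w.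
    apply/eqP/row_matrixP => w; rewrite row0.
    by apply/eqP; rewrite -[_ == _]negbK no_w.
  (* d (i, j) acts on r2 as E_ij, so mapping e_j to w E_ij is G-equivariant. *)
  pose f := \matrix_j row w (gact (d (i, j)) r1).
  apply: (@mx_rsim_irr_hom _ _ _ _ _ _ _ f) => // [x Gx|]; last first.
    by apply: contraNneq nz_w => /(congr1 (row i)); rewrite rowK row0 => ->.
  apply/row_matrixP => j; rewrite !row_mul rowK.
  have [e eE] := gactM G (d (i, j)) (fun y => (y == x)%:R).
  have -> : row w (gact (d (i, j)) r1) *m r1 x = row w (gact e r1).
    by rewrite eE gact_delta // row_mul.
  rewrite -(@ann_eq (fun y => \sum_k r2 x j k * d (i, k) y)).
    rewrite gact_sum raddf_sum mulmx_sum_row /=; apply: eq_bigr => k _.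
    by rewrite gactZ linearZ /= rowK mxE.
  rewrite eE gact_sum gact_delta // dE /=.
  rewrite [in RHS](matrix_sum_delta (r2 x)) mulmx_sumr.
  rewrite [RHS](bigD1 j) //= [X in _ = _ + X]big1 => [|k neq_kj].
    rewrite addr0 mulmx_sumr; apply: eq_bigr => k _.
    by rewrite gactZ dE -scalemxAr mul_delta_mx.
  rewrite mulmx_sumr big1 // => k' _.
  by rewrite -scalemxAr mul_delta_mx_cond eq_sym (negPf neq_kj) mulr0n scaler0.
(* [P] is the two-sided ideal in question. Sandwiching a matrix with non-zero entry (p, q) between
   elementary matrices puts each diagonal [delta_mx i i] in it. *)
pose P A := exists2 e, gact e r1 = A & gact e r2 = 0.
have PD A B : P A -> P B -> P (A + B).
  move=> [e eA e0] [e' e'B e'0]; exists (fun x => e x + e' x).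
    by rewrite gactD eA e'B.
  by rewrite gactD e0 e'0 addr0.
have PM A A' B : P A -> P (B *m A *m A').
  move=> [e eA e0]; have [b bB] := gact_onto B irr1.
  have [a aA] := gact_onto A' irr1.
  have [u uE] := gactM G b e; have [v vE] := gactM G u a.
  by exists v; rewrite vE uE ?bB ?eA ?aA // e0 mulmx0 mul0mx.
change (P 1%:M); rewrite mx1_sum_delta.
elim/big_ind: _ => [||i _]; first by exists (fun=> 0); rewrite gact0.
  exact: PD.
have -> : delta_mx i i = delta_mx i p *m gact c r1
                          *m ((gact c r1 p q)^-1 *: delta_mx q i).
  rewrite {1}[gact c r1]matrix_sum_delta.
  rewrite (bigD1 p) //= mulmxDr mulmx_sumr (bigD1 q) //=.
  rewrite mulmxDl [X in _ + X](_ : _ = 0) ?addr0.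
    rewrite mulmxDl [X in _ + X](_ : _ = 0) ?addr0.
      rewrite -!scalemxAr -scalemxAl !mul_delta_mx scalerA mulVf ?scale1r //.
    rewrite mulmx_suml big1 // => k /negPf nk.
    rewrite -!scalemxAr -scalemxAl mul_delta_mx mul_delta_mx_cond nk.
    by rewrite mulr0n !scaler0.
  rewrite mulmx_sumr mulmx_suml big1 // => k /negPf nk.
  rewrite mulmx_sumr mulmx_suml big1 // => k' _.
  by rewrite -!scalemxAr mul_delta_mx_cond eq_sym nk mulr0n scaler0 mul0mx scaler0.
by apply: PM; exists c.
Qed.

(** Every irreducible module occurs in a composition series of the regular representation, so
    finitely many separating elements, multiplied together, kill all those not isomorphic to [S]. A
    last factor acting on [S] as a diagonal elementary matrix brings the rank down to 1. *)
Lemma gact_isolate n0 (S : reprG n0) :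
  mx_irreducible S ->
  exists c, [/\ gact c S *m gact c S = gact c S, \rank (gact c S) = 1%N &
    forall n (rG : reprG n), mx_irreducible rG -> ~ mx_rsim rG S ->
      gact c rG = 0].
Proof.
move=> irrS; have /mx_irrP[n0_gt0 _] := irrS.
have [U [compU lastU]] := full_series_exists (regular_repr F G).
have [c c1 c0] : exists2 c, gact c S = 1%:M &
    forall i : 'I_(size U), ~ mx_rsim (series_repr i compU) S ->
      gact c (series_repr i compU) = 0.
  suff: exists2 c, gact c S = 1%:M & forall i : 'I_(size U),
      i \in enum 'I_(size U) -> ~ mx_rsim (series_repr i compU) S ->
      gact c (series_repr i compU) = 0.
    by case=> c c1 c0; exists c => // i; apply: c0; rewrite mem_enum.
  elim: (enum _) => [|i s [c c1 c0]].
    by exists (fun x => (x == 1%g)%:R) => //; rewrite gact1.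
  have [sim|nsim] := pselect (mx_rsim (series_repr i compU) S).
    exists c => // j; rewrite inE => /predU1P[-> /(_ sim)//|]; exact: c0.
  have irri := mx_series_repr_irr compU (ltn_ord i).
  have [d d1 d0] := gact_separate irrS irri nsim.
  have [e eE] := gactM G c d; exists e; first by rewrite eE c1 d1 mulmx1.
  move=> j; rewrite inE eE => /predU1P[-> _|/c0 cj /cj->].
    by rewrite d0 mulmx0.
  by rewrite mul0mx.
pose i0 := Ordinal n0_gt0.
have [d dE] := gact_onto (delta_mx i0 i0) irrS.
have [e eE] := gactM G c d.
exists e; rewrite eE c1 dE mul1mx mul_delta_mx mxrank_delta; split=> //.
move=> n rG irr nsim; rewrite eE.
have [i simi] := rsim_regular_series irr compU lastU.
rewrite (gact_rsim_eq0 (mx_rsim_sym simi)) ?mul0mx //; apply: c0.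
by move=> simS; apply: nsim; apply: mx_rsim_trans simS.
Qed.

End Density.

(** * Idempotents computing composition multiplicities *)

Lemma expr_idem (R : pzSemiRingType) (x : R) d : x * x = x -> x ^+ d.+1 = x.
Proof. by move=> idx; elim: d => // d IHd; rewrite exprS IHd. Qed.

Section CompositionSeries.

Variables (F : fieldType) (gT : finGroupType) (G : {group gT}).
Local Notation reprG := (mx_representation F G).
Implicit Types c : gT -> F.

Lemma last_full_series n (rG : reprG n) : (last 0 (full_series rG) :=: 1%:M)%MS.
Proof. by rewrite /full_series; case: cid => U []. Qed.

Lemma gact_series_nilpotent c n (rG : reprG n.+1) U
    (compU : mx_composition_series rG U) :
  (last 0 U :=: 1%:M)%MS ->
  (forall i, (i < size U)%N -> gact c (series_repr i compU) = 0) ->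
  gact c rG ^+ size U = 0.
Proof.
move=> lastU c0.
have nilU i : (i <= size U)%N -> (0 :: U)`_i *m gact c rG ^+ i = 0.
  elim: i => [|i IHi] lt_iU; first by rewrite mul0mx.
  rewrite exprS mulmxA -[LHS]/((_ *m _) *m _).
  have /submxP[D ->] := gact_section_eq0 (c0 i lt_iU).
  by rewrite -mulmxA IHi ?mulmx0 // ltnW.
apply/eqP; rewrite -submx0 -[X in (X <= _)%MS]mul1mx.
rewrite -(eqmxMr _ lastU) (last_nth 0) nilU //.
Qed.

Lemma mxrank_gact_series c n (rG : reprG n) U
    (compU : mx_composition_series rG U) :
  (last 0 U :=: 1%:M)%MS -> gact c rG *m gact c rG = gact c rG ->
  \rank (gact c rG) = (\sum_(i < size U) \rank (gact c (series_repr i compU)))%N.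
Proof.
move=> lastU idc; rewrite -[gact c rG in LHS]mul1mx -(eqmxMr _ lastU) (last_nth 0).
suff rkU k : (k <= size U)%N -> \rank ((0 :: U)`_k *m gact c rG)
    = (\sum_(i < k) \rank (gact c (series_repr i compU)))%N by apply: rkU.
elim: k => [|i IHi] lt_iU; first by rewrite mul0mx mxrank0 big_ord0.
rewrite big_ord_recr /= -IHi ?(ltnW lt_iU) // addnC.
symmetry; apply: mxrank_gact_section_idem => //.
by have [_ /(_ i lt_iU)[/ltmxW]] := compU.
Qed.

End CompositionSeries.

(** For q = p^t, Frobenius applied to X^2 = (X^2 - X) + X gives A^(2q) = (A^2 - A)^q + A^q. The
    computation takes place in polynomials, where commutativity holds. *)
Lemma Frobenius_idempotent (F : fieldType) p t n (A : 'M[F]_n.+1) :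
  p \in [pchar F] -> (A ^+ 2 - A) ^+ (p ^ t)%N = 0 ->
  A ^+ (p ^ t)%N *m A ^+ (p ^ t)%N = A ^+ (p ^ t)%N.
Proof.
move=> pcharF; have pcharP : p \in [pchar {poly F}].
  by rewrite (rmorph_pchar (@polyC F)).
have -> : A ^+ 2 - A = horner_mx A ('X^2 - 'X).
  by rewrite rmorphB rmorphXn /= horner_mx_X.
have pN : [pchar {poly F}].-nat (p ^ t)%N.
  by rewrite pnatX pnatE ?pcharP // (pcharf_prime pcharF).
have := exprDn_pchar ('X^2 - 'X) 'X pN.
rewrite subrK => /(congr1 (horner_mx A)); rewrite rmorphD !rmorphXn /=.
by rewrite horner_mx_X => eqN A0; move: eqN; rewrite A0 add0r -exprM mulnC exprM.
Qed.

Section Multiplicity.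

Variables (F : closedFieldType) (p : nat) (pcharF : p \in [pchar F]).
Variables (gT : finGroupType) (G : {group gT}).
Local Notation reprG := (mx_representation F G).

(** The element of [gact_isolate] is idempotent only on irreducible modules. On a module of
    dimension at most [D] its defect c^2 - c is nilpotent, of order at most the length of a
    composition series, so c^(p^D) is idempotent. Its rank adds up along the series, each factor
    isomorphic to [S] contributing 1; this is why [e] depends on the bound [D]. *)
Lemma mult_idempotent (S : representation F G) D :
  mx_irreducible S ->
  exists e, forall n (rG : reprG n), (n <= D)%N ->
    gact e rG *m gact e rG = gact e rG
    /\ \rank (gact e rG) = composition_mult rG S.
Proof.
move=> irrS; have [c [idc rkc c0]] := gact_isolate irrS.
have [e eE] := gact_horner G c 'X^(p ^ D).
have {}eE n (rG : reprG n.+1) : gact e rG = gact c rG ^+ (p ^ D)%N.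
  by rewrite eE rmorphXn /= horner_mx_X.
have pD_gt0 : (0 < p ^ D)%N by rewrite expn_gt0 prime_gt0 ?(pcharf_prime pcharF).
(* d = c^2 - c kills every irreducible module, so is nilpotent on every module. *)
have [cc ccE] := gactM G c c.
pose d x := cc x + -1 * c x.
have dE n (rG : reprG n) : gact d rG = gact c rG *m gact c rG - gact c rG.
  by rewrite gactD gactZ ccE scaleN1r.
have d_irr n (rG : reprG n) : mx_irreducible rG -> gact d rG = 0.
  move=> irr; have [sim|nsim] := pselect (mx_rsim rG S); last first.
    by rewrite dE c0 // mul0mx subrr.
  by apply: gact_rsim_eq0 (mx_rsim_sym sim) _; rewrite dE idc subrr.
have e_irr n (rG : reprG n) : mx_irreducible rG ->
    \rank (gact e rG) = `[< mx_rsim rG S >].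
  case: n rG => [|n] rG irr; first by case/mx_irrP: irr.
  have [sim|nsim] := asboolP; last first.
    by rewrite eE c0 // expr0n gtn_eqF // mxrank0.
  rewrite -[nat_of_bool _]/1%N -rkc -(mxrank_gact_rsim c sim) eE.
  have idA : gact c rG * gact c rG = gact c rG.
    by apply/eqP; rewrite -subr_eq0 -dE d_irr.
  suff -> : gact c rG ^+ (p ^ D)%N = gact c rG by [].
  by rewrite -(prednK pD_gt0) expr_idem.
exists e => n rG le_nD.
have ide : gact e rG *m gact e rG = gact e rG.
  case: n rG le_nD => [|n] rG le_nD; first by rewrite [RHS]flatmx0 [LHS]flatmx0.
  rewrite eE; apply: Frobenius_idempotent pcharF _.
  have le_size : (size (full_series rG) <= p ^ D)%N.
    have := max_size_mx_series (mx_series_lt (full_seriesP rG)).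
    rewrite last_full_series mxrank1 => /leq_trans; apply.
    by rewrite (leq_trans le_nD) // ltnW // ltn_expl // prime_gt1 ?(pcharf_prime pcharF).
  rewrite -(subnK le_size) exprD; apply/eqP; rewrite expr2 -[_ - _]dE.
  rewrite (gact_series_nilpotent (compU := full_seriesP rG)) ?mulr0 //.
    exact: last_full_series.
  by move=> i lt_i; apply/d_irr/mx_series_repr_irr.
split=> //.
rewrite (mxrank_gact_series (full_seriesP rG) (last_full_series rG) ide).
rewrite /composition_mult count_map -sum1_count [RHS]big_mkcond /=.
have -> : iota 0 (size (full_series rG)) = index_iota 0 (size (full_series rG)).
  by rewrite /index_iota subn0.
rewrite big_mkord.
apply: eq_bigr => i _; rewrite e_irr //.
exact: mx_series_repr_irr.
Qed.

End Multiplicity.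

(** * Embeddings of direct sums *)

Section Embeddings.

Variables (F : fieldType) (gT : finGroupType) (G : {group gT}).
Local Notation repr := (representation F G).
Implicit Types A B C : repr.
Local Notation dadd := (@dadd_grepr F gT G).
Local Notation dsum s := (\big[dadd/@grepr0 F gT G]_(X <- s) X).

Definition embeds A B := exists2 f : 'M_(rdegree A, rdegree B),
  row_free f & forall x, x \in G -> A x *m f = f *m B x.

Lemma embeds_isom_subrep A B : embeds A B -> isom_subrep A B.
Proof.
case=> f free_f hf; exists <<f>>%MS.
have modf : mxmodule B <<f>>%MS.
  rewrite (eqmx_module _ (genmxE f)); apply/mxmoduleP => x Gx.
  by rewrite -hf // submxMl.
exists modf; exists (in_submod <<f>>%MS f); first by rewrite genmxE (eqP free_f).
  by rewrite /row_free mxrank_in_submod ?genmxE.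
move=> x Gx; rewrite -in_submodJ ?genmxE // -hf //; apply: mulmxA.
Qed.

Lemma embeds_trans A B C : embeds A B -> embeds B C -> embeds A C.
Proof.
case=> [f freef hf] [g freeg hg]; exists (f *m g).
  by rewrite /row_free mxrankMfree.
by move=> x Gx; rewrite mulmxA hf // -!mulmxA hg.
Qed.

Lemma embeds_rsim A B : mx_rsim A B -> embeds A B.
Proof. by case=> f _ freef hf; exists f. Qed.

Lemma embeds_refl A : embeds A A.
Proof. exact/embeds_rsim/mx_rsim_refl. Qed.

Lemma embeds_dadd A A' B B' :
  embeds A A' -> embeds B B' -> embeds (dadd A B) (dadd A' B').
Proof.
case=> [f /row_freeP[f' ff'] hf] [g /row_freeP[g' gg'] hg].
exists (block_mx f 0 0 g).
  apply/row_freeP; exists (block_mx f' 0 0 g'); rewrite mulmx_block.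
  by rewrite !(mulmx0, mul0mx, addr0, add0r) ff' gg' -scalar_mx_block.
move=> x Gx /=; rewrite !mulmx_block !(mulmx0, mul0mx, addr0, add0r).
by rewrite hf // hg.
Qed.

Lemma embeds_daddCA A B C : embeds (dadd A (dadd B C)) (dadd B (dadd A C)).
Proof.
pose f a b c : 'M[F]_(a + (b + c), b + (a + c)) :=
  block_mx 0 (row_mx 1%:M 0) (col_mx 1%:M 0) (block_mx 0 0 0 1%:M).
exists (f _ _ _).
  apply/row_freeP; exists (f _ _ _); rewrite /f mulmx_block.
  rewrite mul_row_col mul_row_block mul_block_col mul_col_row mulmx_block.
  rewrite !(mulmx0, mul0mx, addr0, add0r, mulmx1, mul1mx, col_mx0, row_mx0).
  by rewrite add_block_mx !(addr0, add0r) -!scalar_mx_block.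
move=> x Gx /=; rewrite /f !mulmx_block.
rewrite !(mul_mx_row, mul_col_mx, mul_row_block, mul_block_col, mul_row_col).
rewrite !(mulmx_block, mulmx0, mul0mx, mulmx1, mul1mx).
by rewrite !(addr0, add0r, col_mx0, row_mx0).
Qed.

(** Both [f] and [g] are identity matrices, cut into blocks according to the two bracketings, whose
    dimensions are different types. *)
Lemma embeds_daddA A B C : embeds (dadd (dadd A B) C) (dadd A (dadd B C)).
Proof.
pose f a b c : 'M[F]_(a + b + c, a + (b + c)) :=
  block_mx (col_mx 1%:M 0) (block_mx 0 0 1%:M 0) 0 (row_mx 0 1%:M).
pose g a b c : 'M[F]_(a + (b + c), a + b + c) :=
  block_mx (row_mx 1%:M 0) 0 (block_mx 0 1%:M 0 0) (col_mx 0 1%:M).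
exists (f _ _ _).
  apply/row_freeP; exists (g _ _ _); rewrite /f /g mulmx_block.
  rewrite !(mul_row_col, mul_row_block, mul_block_col, mul_col_row, mulmx_block).
  rewrite !(mulmx0, mul0mx, addr0, add0r, mulmx1, mul1mx, col_mx0, row_mx0).
  rewrite -[X in col_mx X]row_mx0 -block_mxEv add_block_mx.
  by rewrite !(addr0, add0r) -!scalar_mx_block.
move=> x Gx /=; rewrite /f !mulmx_block.
rewrite !(mul_mx_row, mul_col_mx, mul_row_block, mul_block_col, mul_row_col).
rewrite !(mulmx_block, mulmx0, mul0mx, mulmx1, mul1mx).
by rewrite !(addr0, add0r, col_mx0, row_mx0).
Qed.

Lemma embeds_dadd0 A : embeds (dadd (@grepr0 F gT G) A) A.
Proof.
exists (col_mx (0 : 'M_(0, _)) 1%:M).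
  apply/row_freeP; exists (row_mx 0 1%:M).
  rewrite mul_col_row !(mulmx0, mul0mx, mulmx1) -[X in block_mx X](flatmx0 1%:M).
  by rewrite -scalar_mx_block.
move=> x Gx /=; rewrite mul_block_col mul_col_mx.
by rewrite !(mulmx0, mul0mx, addr0, add0r, mulmx1, mul1mx).
Qed.

Lemma embeds_dsum_insert A s t :
  embeds (dadd A (dsum (s ++ t))) (dsum (s ++ A :: t)).
Proof.
elim: s => [|B s IHs] /=; first by rewrite big_cons; apply: embeds_refl.
rewrite !big_cons; apply: embeds_trans (embeds_daddCA _ _ _) _.
exact: embeds_dadd (embeds_refl _) IHs.
Qed.

Lemma embeds_dsum s t :
  (forall S : repr, count (fun X : repr => `[< mx_rsim X S >]) s
      <= count (fun X : repr => `[< mx_rsim X S >]) t)%N ->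
  embeds (dsum s) (dsum t).
Proof.
elim: s t => [|A s IHs] t le_st.
  rewrite big_nil; exists 0; last by move=> x _; rewrite mulmx0 mul0mx.
  by rewrite /row_free mxrank0.
have [t1 [A' [t2 [Dt simA]]]] :
    exists t1 A' t2, t = t1 ++ A' :: t2 /\ mx_rsim A' A.
  have: has (fun X : repr => `[< mx_rsim X A >]) t.
    rewrite has_count; apply: leq_trans (le_st A) => /=.
    by rewrite asboolT //; apply: mx_rsim_refl.
  elim: t {le_st} => //= B t IHt /orP[/asboolP simB|/IHt].
    by exists [::], B, t.
  by case=> t1 [A' [t2 [-> simA]]]; exists (B :: t1), A', t2.
rewrite Dt big_cons; apply: embeds_trans (embeds_dsum_insert _ _ _).
apply: embeds_dadd; first exact/embeds_rsim/mx_rsim_sym.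
apply: IHs => S; have := le_st S; rewrite Dt !count_cat /= addnCA.
suff -> : `[< mx_rsim A' S >] = `[< mx_rsim A S >] by rewrite leq_add2l.
apply: asbool_equiv_eq; split; first exact: mx_rsim_trans (mx_rsim_sym simA).
exact: mx_rsim_trans simA.
Qed.

Lemma embeds_muln_dsum A k s :
  embeds (dadd (muln_grepr A k) (dsum s)) (dsum (nseq k A ++ s)).
Proof.
rewrite /muln_grepr; elim: k => [|k IHk] /=.
  by rewrite big_ord0; apply: embeds_dadd0.
rewrite big_ord_recl big_cons; apply: embeds_trans (embeds_daddA _ _ _) _.
exact: embeds_dadd (embeds_refl _) IHk.
Qed.

Lemma embeds_sum_muln (I : finType) (A : I -> repr) (k : I -> nat) s :
  (forall i j, mx_rsim (A i) (A j) -> i = j) ->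
  (forall i, k i <= count (fun X : repr => `[< mx_rsim X (A i) >]) s)%N ->
  embeds (\big[dadd/@grepr0 F gT G]_i muln_grepr (A i) (k i)) (dsum s).
Proof.
move=> A_noniso le_ks.
pose t := flatten [seq nseq (k i) (A i) | i <- index_enum I].
apply: (@embeds_trans _ (dsum t)).
  rewrite /t; elim: (index_enum I) => [|i r IHr] /=.
    by rewrite !big_nil; apply: embeds_refl.
  rewrite big_cons; apply: embeds_trans (embeds_muln_dsum _ _ _).
  exact: embeds_dadd (embeds_refl _) IHr.
apply: embeds_dsum => S; rewrite count_flatten -map_comp sumnE big_map.
rewrite (eq_bigr (fun i => `[< mx_rsim (A i) S >] * k i)%N) => [|i _]; last first.
  by rewrite /= count_nseq.
have [[i simi]|no_i] := pselect (exists i, mx_rsim (A i) S); last first.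
  rewrite big1 // => i _; rewrite asboolF // => simi.
  by apply: no_i; exists i.
rewrite (bigD1 i) //= big1 => [|j neq_ji]; last first.
  rewrite asboolF // => simj; case/eqP: neq_ji; apply: A_noniso.
  exact: mx_rsim_trans simj (mx_rsim_sym simi).
rewrite asboolT // mul1n addn0; apply: leq_trans (le_ks i) _.
apply: sub_count => X /asboolP simX; apply/asboolP.
exact: mx_rsim_trans simX simi.
Qed.

End Embeddings.

(** * Lifting idempotents to characteristic zero *)

Lemma prodr_const_seq (R : pzSemiRingType) (I : eqType) (s : seq I)
    (P : pred I) (E : I -> R) c :
  (forall i, i \in s -> P i -> E i = c) ->
  exists d, \prod_(i <- s | P i) E i = c ^+ d.
Proof.
elim: s => [|i s IHs] Ec; first by exists 0; rewrite big_nil.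
rewrite big_cons; have [|d Dd] := IHs.
  by move=> j sj; apply: Ec; rewrite inE sj orbT.
case: ifP => [Pi|_]; last by exists d.
by exists d.+1; rewrite exprS Dd Ec ?mem_head.
Qed.

Lemma idem_char_poly (F : fieldType) n (A : 'M[F]_n) x :
  A *m A = A -> root (char_poly A) x -> (x == 0) || (x == 1).
Proof.
move=> idA; rewrite -eigenvalue_root_char => /eigenvalueP[v vA nz_v].
have: x *: (x *: v) = x *: v by rewrite -{1}vA scalemxAl -vA -mulmxA idA.
move/eqP; rewrite -subr_eq0 scalerA -scalerBl scaler_eq0 (negPf nz_v) orbF.
by rewrite -{3}[x]mulr1 -mulrBr mulf_eq0 subr_eq0.
Qed.

Section Lifting.

Variables (O : comUnitRingType) (K k : closedFieldType).
Variables (iota : {rmorphism O -> K}) (red : {rmorphism O -> k}).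
Hypothesis iota_inj : injective iota.
Hypothesis red_surj : forall y, exists x, red x = y.
Hypothesis O_closed : forall p : {poly O}, p \is monic ->
  forall x, root (map_poly iota p) x -> exists y, iota y = x.

(** A non-vanishing minor lifts to a non-vanishing minor: here [A] and [B] cut out of the reduction
    an identity matrix of maximal size, and the determinant of their lift reduces to 1. *)
Lemma mxrank_red m n (M : 'M[O]_(m, n)) :
  (\rank (map_mx red M) <= \rank (map_mx iota M))%N.
Proof.
have /choice[lift liftK] := red_surj.
have lift_mx p q (A : 'M[k]_(p, q)) : map_mx red (map_mx lift A) = A.
  by apply/matrixP => i j; rewrite !mxE liftK.
set N := map_mx red M; pose r := \rank N.
pose A : 'M[k]_(r, m) := pid_mx r *m invmx (col_ebase N).
pose B : 'M[k]_(n, r) := invmx (row_ebase N) *m pid_mx r.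
have ANB : A *m N *m B = 1%:M.
  rewrite -[X in A *m X](mulmx_ebase N) /A /B !mulmxA.
  rewrite mulmxKV ?col_ebase_unit // mulmxK ?row_ebase_unit //.
  rewrite !pid_mx_id ?rank_leq_row ?rank_leq_col //; exact: pid_mx_1.
pose C := map_mx lift A *m M *m map_mx lift B.
have detC : iota (\det C) != 0.
  rewrite -(rmorph0 iota) (inj_eq iota_inj); apply/eqP => /(congr1 red).
  rewrite -det_map_mx !map_mxM !lift_mx -/N ANB det1 rmorph0.
  exact/eqP/oner_neq0.
have unitC : map_mx iota C \in unitmx by rewrite unitmxE det_map_mx unitfE.
rewrite -/r -(mxrank_unit unitC) !map_mxM -mulmxA.
exact: leq_trans (mxrankM_maxr _ _) (mxrankM_maxl _ _).
Qed.

Lemma monic_splits (p : {poly O}) :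
  p \is monic -> exists s : seq O, p = \prod_(y <- s) ('X - y%:P).
Proof.
move=> mon_p; have [s Ds] := closed_field_poly_normal (map_poly iota p).
have monK : map_poly iota p \is monic by rewrite monic_map.
move: Ds; rewrite (monicP monK) scale1r => Ds.
have [t Dt] : exists t, s = map iota t.
  have: all (root (map_poly iota p)) s.
    by apply/allP => x sx; rewrite Ds root_prod_XsubC.
  elim: s {Ds} => [|x s IHs] /=; first by exists [::].
  case/andP=> /(O_closed mon_p)[y <-] /IHs[t ->].
  by exists (y :: t).
exists t; apply: (map_inj_poly iota_inj (rmorph0 _)).
rewrite Ds Dt big_map rmorph_prod /=; apply: eq_bigr => y _.
by rewrite rmorphB /= map_polyX map_polyC.
Qed.

(** Let a lift e. The eigenvalues of a on the lattices lie in O and reduce to 0 or 1; accordingly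
    they are distributed over two polynomials f0 and f1, coprime over K, whose product kills a. Then
    b = f0(a) and b' = f1(a) lift e and 1 - e, and a Bezout relation u f0 + v f1 = 1 makes f = (u
    f0)(a) idempotent. *)
Lemma lift_idempotent (gT : finGroupType) (G : {group gT}) (J : finType)
    (r : J -> nat) (L : forall j, mx_representation O G (r j)) (e : gT -> k) :
  (forall j, gact e (map_repr red (L j)) *m gact e (map_repr red (L j))
               = gact e (map_repr red (L j))) ->
  exists (b : gT -> O) (f : gT -> K), forall j,
    let bj := map_mx iota (gact b (L j)) in
    let fj := gact f (map_repr iota (L j)) in
    [/\ map_mx red (gact b (L j)) = gact e (map_repr red (L j)),
        fj *m fj = fj, (fj :=: bj)%MS
      & \rank fj = \rank (gact e (map_repr red (L j)))].
Proof.
move=> ide; have /choice[a Da] : forall x, exists y, red y = e x by [].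
have redA j : map_mx red (gact a (L j)) = gact e (map_repr red (L j)).
  by rewrite map_gact; apply: eq_bigr => x _; rewrite /= Da.
pose P := \prod_j char_poly (gact a (L j)).
have [|s Ds] := @monic_splits P.
  by apply: monic_prod => j _; apply: char_poly_monic.
have red_s y : y \in s -> red y != 0 -> red y = 1.
  move=> sy nz_y; have: root (map_poly red P) (red y).
    rewrite Ds rmorph_prod /= (big_rem y sy) /= rootM.
    by rewrite map_polyXsubC root_XsubC eqxx.
  rewrite rmorph_prod /= /root horner_prod prodf_seq_eq0 => /hasP[j _] /=.
  rewrite -/(root _ _) map_char_poly redA => /(idem_char_poly (ide j)).
  by rewrite (negPf nz_y) => /eqP.
(* The factors 'X and 1 - 'X ensure that red f0 and red f1 are positive powers,
   so that they take an idempotent E to E and 1 - E. *)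
pose f0 := 'X * \prod_(y <- s | red y == 0) ('X - y%:P).
pose f1 := (1 - 'X) * \prod_(y <- s | red y != 0) (y%:P - 'X).
have [w Df01] : exists w, f0 * f1 = w * P.
  exists ('X * (1 - 'X) * \prod_(y <- s | red y != 0) -1).
  have -> : P = \prod_(y <- s | red y == 0) ('X - y%:P)
                * \prod_(y <- s | red y != 0) ('X - y%:P).
    by rewrite Ds (bigID (fun y => red y == 0)).
  rewrite /f0 /f1.
  rewrite [\prod_(y <- s | _ != _) (_ - 'X)](eq_bigr (fun y => -1 * ('X - y%:P))).
    rewrite big_split /=; set u := \prod_(i <- s | _) -1.
    by rewrite -!mulrA; congr (_ * _); rewrite mulrCA; congr (_ * _); rewrite mulrCA.
  by move=> y _; rewrite mulN1r opprB.
have red_f0 : exists d, map_poly red f0 = 'X ^+ d.+1.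
  have [|d Dd] := @prodr_const_seq {poly k} _ s (fun y => red y == 0)
      (fun y => 'X - (red y)%:P) 'X.
    by move=> y _ /eqP->; rewrite subr0.
  by exists d; rewrite rmorphM /= map_polyX map_prod_XsubC Dd exprS.
have red_f1 : exists d, map_poly red f1 = (1 - 'X) ^+ d.+1.
  have [|d Dd] := @prodr_const_seq {poly k} _ s (fun y => red y != 0)
      (fun y => map_poly red (y%:P - 'X)) (1 - 'X).
    by move=> y sy nz_y; rewrite -opprB rmorphN /= map_polyXsubC red_s // opprB.
  by exists d; rewrite rmorphM rmorphB rmorph1 rmorph_prod /= map_polyX Dd exprS.
(* A common root would come from an element of O reducing both to 0 and to 1. *)
have cop : coprimep (map_poly iota f0) (map_poly iota f1).
  apply: Pdiv.ClosedField.root_coprimep => x.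
  rewrite rmorphM rootM /= map_polyX rootX => root0.
  have [y Dx red_y] : exists2 y, iota y = x & red y = 0.
    case/orP: root0 => [/eqP->|]; first by exists 0; rewrite rmorph0.
    rewrite /root rmorph_prod horner_prod prodf_seq_eq0 => /hasP[y _ /andP[/eqP y0]].
    rewrite /= map_polyXsubC -/(root _ _) root_XsubC => /eqP Dx.
    by exists y.
  have not_y z : red z = 1 -> iota z != x.
    move=> z1; rewrite -Dx (inj_eq iota_inj); apply/eqP => zy.
    by have/eqP := oner_neq0 k; rewrite -z1 zy red_y.
  rewrite rmorphM rmorphB rmorph1 rmorph_prod /= map_polyX hornerM mulf_neq0 //.
    rewrite !hornerE subr_eq0; apply: contraTneq (not_y 1 (rmorph1 _)) => <-.
    by rewrite rmorph1 eqxx.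
  rewrite horner_prod prodf_seq_neq0; apply/allP => z sz; apply/implyP => nz_z.
  rewrite -[z%:P - 'X]opprB rmorphN /= map_polyXsubC hornerN hornerXsubC.
  by rewrite oppr_eq0 subr_eq0 eq_sym not_y // red_s.
have [[u v] /= uv1] := Bezout_eq1_coprimepP _ _ cop.
have [b Db] := gact_horner G a f0; have [b' Db'] := gact_horner G a f1.
have [f Df] := gact_horner G (iota \o a) (u * map_poly iota f0).
exists b, f => j.
have redb : map_mx red (gact b (L j)) = gact e (map_repr red (L j)).
  case: (r j) (L j) (redA j) (ide j) => [|n] Lj redAj idej.
    by rewrite [RHS]flatmx0 [LHS]flatmx0.
  have [d Dd] := red_f0.
  by rewrite Db map_horner_mx redAj Dd rmorphXn /= horner_mx_X expr_idem.
have redb' : map_mx red (gact b' (L j)) = 1%:M - gact e (map_repr red (L j)).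
  case: (r j) (L j) (redA j) (ide j) => [|n] Lj redAj idej.
    by rewrite [RHS]flatmx0 [LHS]flatmx0.
  have [d Dd] := red_f1.
  rewrite Db' map_horner_mx redAj Dd rmorphXn rmorphB rmorph1 /= horner_mx_X.
  rewrite expr_idem // -[LHS]/(_ * _) mulrBr mulr1 mulrBl mul1r.
  by rewrite [X in _ - (_ - X)]idej subrr subr0.
have [idf sub_b sub_b' bb'] :
  let bj := map_mx iota (gact b (L j)) in
  let bj' := map_mx iota (gact b' (L j)) in
  let fj := gact f (map_repr iota (L j)) in
    [/\ fj *m fj = fj, (fj <= bj)%MS, (1%:M - fj <= bj')%MS & bj *m bj' = 0].
  have: P = char_poly (gact a (L j)) * \prod_(i | i != j) char_poly (gact a (L i)).
    by rewrite /P (bigD1 j).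
  case: (r j) (L j) => [|n] Lj DP.
    by split; rewrite ?flatmx0 ?sub0mx // [LHS]flatmx0 [RHS]flatmx0.
  have A0 : horner_mx (gact a Lj) (f0 * f1) = 0.
    by rewrite Df01 DP !rmorphM /= Cayley_Hamilton mul0r mulr0.
  have A0K : horner_mx (map_mx iota (gact a Lj)) (map_poly iota (f0 * f1)) = 0.
    by rewrite -map_horner_mx A0 map_mx0.
  have Df' : gact f (map_repr iota Lj)
             = horner_mx (map_mx iota (gact a Lj)) (u * map_poly iota f0).
    by rewrite Df map_gact.
  have D1f : 1%:M - gact f (map_repr iota Lj)
             = horner_mx (map_mx iota (gact a Lj)) (v * map_poly iota f1).
    apply/eqP; rewrite subr_eq Df' -rmorphD /= addrC uv1; apply/eqP.
    by rewrite (rmorph1 (horner_mx _)).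
  split.
  - apply/eqP; rewrite eq_sym -subr_eq0 -{1}[gact f _]mulmx1 -mulmxBr D1f Df'.
    rewrite -[_ *m _]rmorphM mulrACA -rmorphM /= rmorphM /= A0K mulr0.
    exact: eqxx.
  - by rewrite Df' rmorphM /= Db map_horner_mx submxMl.
  - by rewrite D1f rmorphM /= Db' map_horner_mx submxMl.
  - by rewrite -map_mxM /= Db Db' -[_ *m _]rmorphM /= A0 map_mx0.
move: sub_b sub_b' bb' idf => /=.
set bj := map_mx iota (gact b (L j)); set bj' := map_mx iota (gact b' (L j)).
set fj := gact f _; set ej := gact e _ => sub_b sub_b' /mulmx0_rank_max le_bb' idf.
have le_eb : (\rank ej <= \rank bj)%N by rewrite /ej -redb mxrank_red.
have le_eb' : (\rank (1%:M - ej)%R <= \rank bj')%N by rewrite /ej -redb' mxrank_red.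
have le_fb := mxrankS sub_b; have le_fb' := mxrankS sub_b'.
have le1 (F : fieldType) (A : 'M[F]_(r j)) : (r j <= \rank A + \rank (1%:M - A)%R)%N.
  apply: leq_trans (mxrank_add _ _); rewrite addrC subrK.
  by rewrite mxrank1.
have le_f := le1 _ fj; have le_e := le1 _ ej.
(* The ranks of b and b' sum to at most the dimension, since b b' = 0, and they dominate the ranks
   of e, 1 - e and of f, 1 - f, each pair summing to at least the dimension. So all these
   inequalities are equalities. *)
have squeeze (d x x' y y' z z' : nat) : (d <= x + x')%N -> (d <= z + z')%N ->
    (x <= y)%N -> (x' <= y')%N -> (z <= y)%N -> (z' <= y')%N ->
    (y + y' <= d)%N -> z = x /\ (y <= z)%N by lia.
have [rank_fe le_bf] := 
  squeeze _ _ _ _ _ _ _ le_e le_f le_eb le_eb' le_fb le_fb' le_bb'.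
split=> //; apply/eqmxP.
by rewrite sub_b -(geq_leqif (mxrank_leqif_sup sub_b)).
Qed.

End Lifting.

(** * Integral sums of roots of unity *)

Lemma mxtrace_idem (F : fieldType) n (A : 'M[F]_n) :
  A *m A = A -> \tr A = (\rank A)%:R.
Proof.
move=> idA; have RC1 : row_base A *m col_base A = 1%:M.
  apply: (row_free_inj (row_base_free A)); rewrite /= mul1mx.
  apply: (row_full_inj (col_base_full A)).
  by rewrite -(mulmxA (row_base A)) !mulmx_base mulmxA mulmx_base idA.
by rewrite -[in LHS](mulmx_base A) mxtrace_mulC RC1 mxtrace1.
Qed.

Section Cyclotomic.

Variables (l : nat) (l_pr : prime l).
Local Notation Phi := (\poly_(i < l) 1).

Let size_Phi (R : nzRingType) : size (Phi : {poly R}) = l.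
Proof. by rewrite size_poly_eq ?oner_neq0. Qed.

Let Phi_sum (R : comNzRingType) (x : R) : x ^+ l - 1 = (x - 1) * Phi.[x].
Proof.
by rewrite subrX1 horner_poly; congr (_ * _); apply: eq_bigr => i _; rewrite mul1r.
Qed.

Let map_Phi (R S : nzRingType) (f : {rmorphism R -> S}) : map_poly f Phi = Phi.
Proof.
by apply/polyP => i; rewrite coef_map /= !coef_poly; case: ifP; rewrite ?rmorph1 ?rmorph0.
Qed.

Lemma root_Phi_prim (R : fieldType) (x : R) :
  l%:R != 0 :> R -> root Phi x -> l.-primitive_root x.
Proof.
move=> nz_l /rootP Phix.
have xl1 : x ^+ l = 1 by apply/eqP; rewrite -subr_eq0 Phi_sum Phix mulr0.
have [d prim_x] := prim_order_exists (prime_gt0 l_pr) xl1.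
case/primeP: l_pr => _ dvd_l /dvd_l/predU1P[d1|/eqP<-//].
move: prim_x Phix; rewrite d1 => /prim_expr_order; rewrite expr1 => ->.
rewrite horner_poly (eq_bigr (fun=> 1)) => [|i _]; last by rewrite expr1n mulr1.
by rewrite sumr_const card_ord => /eqP; rewrite (negPf nz_l).
Qed.

Lemma closed_prim_root_exists (K : closedFieldType) :
  l%:R != 0 :> K -> exists x : K, l.-primitive_root x.
Proof.
move=> nz_l; have [x Phix] : exists x : K, root Phi x.
  by apply/closed_rootP; rewrite size_Phi gtn_eqF ?prime_gt1.
by exists x; apply: root_Phi_prim.
Qed.

(** Irreducibility of the [l]-th cyclotomic polynomial: a non-constant gcd has a root in [algC],
    which is a primitive [l]-th root of unity, and its minimal polynomial already has the degree of
    [Phi]. *)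
Lemma Phi_dvd_or_coprime (p : {poly rat}) : Phi %| p \/ coprimep p Phi.
Proof.
pose g := gcdp p Phi; have dvd_gPhi : g %| Phi by apply: dvdp_gcdr.
have [|size_g] := boolP (coprimep p Phi); [by right|left].
pose gC : {poly algC} := map_poly ratr g.
have Phi0 : (Phi : {poly rat}) != 0 by rewrite -size_poly_gt0 size_Phi prime_gt0.
have [x gx] : exists x, root gC x.
  apply/closed_rootP; rewrite size_map_poly.
  by apply: contra size_g; rewrite /coprimep.
have prim_x : l.-primitive_root x.
  apply: root_Phi_prim; first by rewrite Num.Theory.pnatr_eq0 -lt0n prime_gt0.
  rewrite -(map_Phi (ratr : {rmorphism rat -> algC})).
  by move: gx; rewrite -!dvdp_XsubCl => /dvdp_trans; apply; rewrite dvdp_map.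
have [q [Dq _] qP] := minCpolyP x.
have size_q : size q = l.
  rewrite -(size_map_poly (ratr : {rmorphism rat -> algC})) -Dq.
  rewrite (minCpoly_cyclotomic prim_x) size_cyclotomic totient_prime //.
  by rewrite prednK ?prime_gt0.
have dvd_qg : q %| g by rewrite -qP.
apply: dvdp_trans (dvdp_gcdl p Phi).
have g0 : g != 0 by apply: contraNneq Phi0 => g0; rewrite -dvd0p -g0.
have : size g == size (Phi : {poly rat}).
  by rewrite eqn_leq dvdp_leq // size_Phi -size_q dvdp_leq.
by rewrite (dvdp_size_eqp dvd_gPhi) => /andP[].
Qed.

(** The relation is a polynomial of degree below [l] vanishing at [y]. It is therefore a constant
    multiple of 1 + X + ... + X^(l-1), and its coefficients of degrees 0 and 1 agree. *)
Lemma prim_root_integer_sum (K : fieldType) (K0 : forall n, n.+1%:R != 0 :> K)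
    (y : K) (c : nat -> nat) (m : int) :
  l.-primitive_root y -> \sum_(i < l) (c i)%:R * y ^+ i = m%:~R ->
  (c 1)%:Z = (c 0)%:Z - m.
Proof.
move=> prim_y sum_y; have l_gt1 := prime_gt1 l_pr.
have intr_neq0 (d : int) : d != 0 -> d%:~R != 0 :> K.
  by case: d => [[|d]|d] // _; rewrite ?NegzE ?mulrNz ?oppr_eq0 -pmulrn K0.
pose p : {poly int} := \poly_(i < l) ((c i)%:Z - (if i == 0 then m else 0)).
pose pQ : {poly rat} := map_poly intr p.
have py : (map_poly intr p).[y] = 0.
  have -> : map_poly intr p
      = \poly_(i < l) ((c i)%:R - (if i == 0 then m%:~R else 0)) :> {poly K}.
    apply/polyP => i; rewrite coef_map /= !coef_poly; case: ifP => // _.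
    by rewrite rmorphB /= -pmulrn; case: ifP.
  rewrite horner_poly; under eq_bigr do rewrite mulrBl.
  rewrite sumrB sum_y -(prednK (prime_gt0 l_pr)) big_ord_recl /=.
  by rewrite big1 ?addr0 ?mulr1 ?subrr // => i _; rewrite mul0r.
have Phiy : Phi.[y] = 0.
  have nz_y1 : y - 1 != 0.
    rewrite subr_eq0 -(expr1 y) -(prim_order_dvd prim_y).
    by rewrite dvdn1 gtn_eqF.
  by apply/eqP; rewrite -(mulrI_eq0 _ (mulfI nz_y1)) -Phi_sum
    (prim_expr_order prim_y) subrr.
have [dvdp|/Bezout_eq1_coprimepP[[u v] /= uv1]] :=
    Phi_dvd_or_coprime pQ.
  have [q Dq] := dvdpP _ _ dvdp.
  have /size1_polyC Dq0 : (size q <= 1)%N.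
    have [->|nz_q] := eqVneq q 0; first by rewrite size_poly0.
    have: (size pQ <= l)%N by rewrite size_rat_int_poly size_poly.
    rewrite Dq size_mul // ?size_Phi; last by rewrite -size_poly_gt0 size_Phi prime_gt0.
    by move: (size q) => d; lia.
  have coefp i : (i < l)%N -> pQ`_i = q`_0.
    by move=> lt_il; rewrite Dq Dq0 coefCM coefC eqxx coef_poly lt_il mulr1.
  have := etrans (coefp _ l_gt1) (esym (coefp _ (prime_gt0 l_pr))).
  rewrite !coef_map /= !coef_poly l_gt1 prime_gt0 //= subr0.
  exact: intr_inj.
(* Denominators are cleared so that the Bezout relation can be evaluated in [K] along the integers;
   it then makes a non-zero integer vanish there. *)
have [[U [a nz_a Du]] [W [b nz_b Dv]]] := (rat_poly_scale u, rat_poly_scale v).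
have UW : b *: U * p + a *: W * Phi = (a * b)%:P.
  apply: (map_inj_poly (intr_inj : injective (intr : int -> rat)) (rmorph0 _)).
  rewrite rmorphD !rmorphM /= map_Phi map_polyC.
  have DU : map_poly intr U = a%:~R *: u by rewrite Du scalerA mulfV ?scale1r // intr_eq0.
  have DW : map_poly intr W = b%:~R *: v by rewrite Dv scalerA mulfV ?scale1r // intr_eq0.
  rewrite !map_polyZ /= DU DW -!scalerAl !scalerA [b%:~R * _]mulrC -scalerDr uv1.
  by rewrite alg_polyC polyCM !map_polyC.
have := congr1 (fun q : {poly int} => (map_poly intr q).[y] : K) UW.
rewrite map_polyC hornerC rmorphD hornerD !rmorphM /= map_Phi !hornerM py Phiy.
rewrite !mulr0 addr0 => /esym/eqP.
by rewrite (negPf (intr_neq0 _ _)) ?mulf_neq0.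
Qed.

End Cyclotomic.

(** * Eigenspaces of sigma and the Tate groups *)

Section IntegralClosureFacts.

Variables (l : nat) (l_pr : prime l) (K : fieldType).
Variable incl : {rmorphism Ql l_pr -> K}.

Lemma padic_natE n i : (n%:R : padic_int l_pr) i = (n%:Z %% (l ^ i)%N%:Z)%Z.
Proof.
elim: n => [|n IHn]; first by rewrite mulr0n.
by rewrite -addn1 natrD /= IHn modzDml modzDmr PoszD.
Qed.

Lemma Ql_extension_char0 n : n.+1%:R != 0 :> K.
Proof.
rewrite -(rmorph_nat incl) fmorph_eq0 -(rmorph_nat (@tofrac (padic_int l_pr))).
rewrite tofrac_eq0; apply/eqP => /(congr1 (fun x : padic_int l_pr => x n.+1)).
have lt_n : (n.+1 < l ^ n.+1)%N by rewrite ltn_expl // prime_gt1.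
by rewrite padic_natE /= mod0z modz_small // ltz_nat lt_n.
Qed.

Lemma Zlbar_closed (p : {poly Zlbar incl}) : p \is monic ->
  forall x, root (map_poly val p) x -> exists y : Zlbar incl, val y = x.
Proof.
move=> mon_p x px; have intx : x \in in_Zlbar incl.
  apply/asboolP; apply: (integral_root_monic _ px) => [|z].
    by rewrite monic_map.
  move=> /(nthP 0)[i _ <-]; rewrite coef_map /=.
  exact/asboolP/(valP p`_i).
by exists (InZlbar intx).
Qed.

End IntegralClosureFacts.

Section TateBound.

Variables (l : nat) (l_pr : prime l) (O : comUnitRingType) (K k : closedFieldType).
Variables (iota : {rmorphism O -> K}) (red : {rmorphism O -> k}).
Hypothesis iota_inj : injective iota.
Hypothesis red_surj : forall y, exists x, red x = y.
Hypothesis O_closed : forall p : {poly O}, p \is monic ->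
  forall x, root (map_poly iota p) x -> exists y, iota y = x.
Hypothesis K_char0 : forall n, n.+1%:R != 0 :> K.
Hypothesis k_char : l \in [pchar k].

Let l_gt0 : (0 < l)%N := prime_gt0 l_pr.

Let natK_neq0 : l%:R != 0 :> K.
Proof. by rewrite -(prednK l_gt0). Qed.

(** By Frobenius, (red y - 1)^l = red (y^l) - 1 = 0. *)
Lemma prim_root_lift :
  exists z : O, l.-primitive_root (iota z) /\ red z = 1.
Proof.
have [x prim_x] := closed_prim_root_exists l_pr natK_neq0.
have [|y Dy] := O_closed (monicXnsubC 1 l_gt0) (x := x).
  by rewrite rmorphB /= map_polyXn map_polyC /= rmorph1 /root !hornerE
             (prim_expr_order prim_x) subrr.
exists y; rewrite Dy; split=> //.
have yl : y ^+ l = 1.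
  by apply: iota_inj; rewrite rmorphXn /= Dy (prim_expr_order prim_x) rmorph1.
apply/eqP; rewrite -subr_eq0; have: pFrobenius_aut k_char (red y - 1) == 0.
  by rewrite rmorphB rmorph1 /= pFrobenius_autE -rmorphXn /= yl rmorph1 subrr.
by rewrite pFrobenius_autE expf_eq0 => /andP[].
Qed.

Lemma exprZ_mx (R : comPzRingType) n (c : R) (A : 'M_n) i :
  (c *: A) ^+ i = c ^+ i *: A ^+ i.
Proof.
elim: i => [|i IHi]; first by rewrite scale1r.
by rewrite !exprS IHi -[LHS]scalemxAl -scalemxAr scalerA.
Qed.

Variables (n : nat) (S : 'M[O]_n).
Hypothesis Sl : S ^+ l = 1.

Section Projectors.

Variables (x : K) (j : nat).
Hypothesis xl : x ^+ l = 1.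
Let P := x *: map_mx iota S.

Let Pl : P ^+ l = 1.
Proof. by rewrite exprZ_mx xl scale1r -rmorphXn /= Sl rmorph1. Qed.

Lemma eigenproj_killed : (1 - P) *m (\sum_(i < l) P ^+ i) = 0.
Proof. by rewrite -opprB mulNmx -[_ *m _]subrX1 Pl subrr oppr0. Qed.

(** The sum is [l] times the projector onto the vectors fixed by [P], the eigenspace of [S] for the
    eigenvalue x^-1. *)
Lemma eigenproj_idem :
  (\sum_(i < l) P ^+ i) *m (\sum_(i < l) P ^+ i) = l%:R *: \sum_(i < l) P ^+ i.
Proof.
rewrite mulmx_suml (eq_bigr (fun=> \sum_(i < l) P ^+ i)) => [|i _].
  by rewrite sumr_const card_ord scaler_nat.
elim: {i}(i : nat) => [|i IHi]; first by rewrite expr0 mul1mx.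
rewrite exprSr -[_ * _]/(_ *m _) -mulmxA; have := eigenproj_killed.
by rewrite mulmxBl mul1mx => /eqP; rewrite subr_eq0 => /eqP<-.
Qed.

End Projectors.

(** The number [r j] is the dimension of the eigenspace of sigma for zeta^-j on the image of [f].
    Every j gives bounds on the same two ranks modulo l, and the conclusion compares those for j = 0
    and j = 1. *)
Lemma tate_bound (B : 'M[O]_n) (f : 'M[K]_n) (m : int) :
  let E := map_mx red B in let T := map_mx red S in
  f *m f = f -> f *m map_mx iota S = map_mx iota S *m f ->
  (f :=: map_mx iota B)%MS -> \rank f = \rank E ->
  \tr (f *m map_mx iota S) = m%:~R ->
  (\rank (E *m (1%:M - T))%R + \rank (E *m \sum_(i < l) T ^+ i)%R + `|m| <= \rank E)%N.
Proof.
move=> E T idf comm_fS eq_fB rank_fE tr_fS.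
have [z [prim_z red_z]] := prim_root_lift.
set SK := map_mx iota S in comm_fS tr_fS *.
pose P j := z ^+ j *: S; pose N j := \sum_(i < l) P j ^+ i.
pose PK j := iota z ^+ j *: SK; pose NK j := \sum_(i < l) PK j ^+ i.
have zjl j : (iota z ^+ j) ^+ l = 1.
  by rewrite -exprM mulnC exprM (prim_expr_order prim_z) expr1n.
have mapP j : map_mx iota (P j) = PK j by rewrite map_mxZ rmorphXn.
have mapN j : map_mx iota (N j) = NK j.
  by rewrite rmorph_sum /=; apply: eq_bigr => i _; rewrite rmorphXn /= mapP.
have redP j : map_mx red (P j) = T.
  by rewrite map_mxZ rmorphXn /= red_z expr1n scale1r.
have redN j : map_mx red (N j) = \sum_(i < l) T ^+ i.
  by rewrite rmorph_sum /=; apply: eq_bigr => i _; rewrite rmorphXn /= redP.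
pose r j := \rank (f *m NK j).
have le_N j : (\rank (E *m \sum_(i < l) T ^+ i)%R <= r j)%N.
  rewrite -(redN j) -map_mxM (leq_trans (mxrank_red iota_inj red_surj _)) //.
  by rewrite map_mxM mapN -(eqmxMr _ eq_fB).
have comm_fP j : f * PK j = PK j * f.
  by rewrite -[LHS]scalemxAr comm_fS scalemxAl.
have comm_fN j : f *m NK j = NK j *m f.
  rewrite mulmx_sumr mulmx_suml; apply: eq_bigr => i _.
  exact: (commrX i (comm_fP j)).
have le_D j : (\rank (E *m (1%:M - T))%R + r j <= \rank f)%N.
  have red1P : map_mx red (1%:M - P j) = 1%:M - T.
    by rewrite map_mxB map_mx1 redP.
  (* The added term is the rank of a zero product, which brings the sum into the shape of the
     Frobenius rank inequality. *)
  have -> : \rank f = (\rank f + \rank ((1%:M - PK j) *m f *m NK j)%R)%N.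
    rewrite -mulmxA comm_fN mulmxA [_ *m NK j]eigenproj_killed //.
    by rewrite mul0mx mxrank0 addn0.
  apply: leq_trans (mxrank_Frobenius _ _ _); rewrite leq_add2r.
  rewrite -red1P -map_mxM (leq_trans (mxrank_red iota_inj red_surj _)) //.
  rewrite map_mxM -(eqmxMr _ eq_fB) map_mxB map_mx1 mapP.
  by rewrite mulmxBl mulmxBr mulmx1 mul1mx [f *m _]comm_fP.
have tr_N j : \tr (f *m NK j) = l%:R * (r j)%:R.
  have nz_lV : l%:R^-1 != 0 :> K by rewrite invr_eq0.
  rewrite -[LHS](mulVKf natK_neq0); congr (_ * _).
  rewrite -mxtraceZ mxtrace_idem ?mxrank_scale_nz //.
  have idN : (f *m NK j) *m (f *m NK j) = l%:R *: (f *m NK j).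
    rewrite mulmxA -(mulmxA f) -comm_fN mulmxA idf -mulmxA eigenproj_idem //.
    by rewrite scalemxAr.
  by rewrite -scalemxAl -scalemxAr idN !scalerA -mulrA mulVf // mulr1.
pose y := iota z ^+ l.-1.
have prim_y : l.-primitive_root y.
  by rewrite prim_root_exp_coprime // coprime_sym coprimenP.
have sum_r : \sum_(j < l) (r j)%:R * y ^+ j = m%:~R.
  apply: (mulfI natK_neq0); rewrite -tr_fS -mxtraceZ scalemxAr.
  (* Fourier inversion with y = zeta^-1: the coefficient of sigma^i is the sum over j of
     zeta^((i-1)j), which is l for i = 1 and 0 otherwise. *)
  have <- : \sum_(j < l) y ^+ j *: NK j = l%:R *: SK.
    transitivity (\sum_(i < l) (\sum_(j < l) (iota z ^+ (l.-1 + i)) ^+ j) *: SK ^+ i).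
      under eq_bigr do rewrite scaler_sumr.
      rewrite exchange_big; apply: eq_bigr => i _; rewrite scaler_suml.
      apply: eq_bigr => j _; rewrite exprZ_mx scalerA; congr (_ *: _).
      by rewrite -!exprM -exprD mulnDl [(j * i)%N]mulnC.
    rewrite (bigD1 (Ordinal (prime_gt1 l_pr))) //= [X in _ + X]big1 ?addr0 => [|i neq_i1].
      rewrite addn1 prednK // (prim_expr_order prim_z).
      by under eq_bigr do rewrite expr1n; rewrite sumr_const card_ord expr1.
    set w := iota z ^+ _; have wl : w ^+ l = 1 by apply: zjl.
    have w1 : w - 1 != 0.
      rewrite subr_eq0 -(prim_order_dvd prim_z); apply: contra neq_i1.
      have l_gt1 := prime_gt1 l_pr; have lt_il := ltn_ord i.
      move=> /dvdnP[[|[|q]] Dq]; rewrite -val_eqE /=; first by lia.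
        by apply/eqP; lia.
      by rewrite !mulSn in Dq; lia.
    have /eqP : (w - 1) * \sum_(j < l) w ^+ j = 0 by rewrite -subrX1 wl subrr.
    by rewrite mulf_eq0 (negPf w1) /= => /eqP->; rewrite scale0r.
  rewrite mulmx_sumr raddf_sum mulr_sumr /=; apply: eq_bigr => j _.
  by rewrite -scalemxAr mxtraceZ tr_N mulrA mulrC.
have := prim_root_integer_sum l_pr K_char0 prim_y sum_r.
have := (le_N 0%N, le_N 1%N, le_D 0%N, le_D 1%N); rewrite -rank_fE.
move: (\rank f) (r 0%N) (r 1%N) (\rank _) (\rank _) => x0 x1 x2 x3 x4.
by case=> [[[? ?] ?] ?]; lia.
Qed.

End TateBound.

(** * Tate groups of a module over the semidirect product *)

Lemma mxrank_idem_ker (F : fieldType) n (A X : 'M[F]_n) :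
  A *m A = A -> (\rank A <= \rank (A *m X) + \rank (kermx X *m A))%N.
Proof.
move=> idA; rewrite -(mxrank_mul_ker A X) leq_add2l; apply: mxrankS.
set C := (_ :&: _)%MS; have <- : C *m A = C by apply: submx_idem; rewrite ?capmxSl.
exact/submxMr/capmxSr.
Qed.

Section SemidirectElements.

Variables (gT : finGroupType) (G : {group gT}) (s : {perm gT}) (As : s \in Aut G).
Local Notation H := (fixed_subgroup G s).

Lemma sd_elt1X i : sd_elt As 1%g i = (sd_elt As 1%g 1 ^+ i)%g.
Proof.
rewrite /sd_elt morph1 !mul1g expg1 -morphX //.
by rewrite cycle_id.
Qed.

Lemma sd_eltE g : sd_elt As g 1 = (sdpair1 (sd_act As) g * sd_elt As 1 1)%g.
Proof. by rewrite /sd_elt morph1 mul1g. Qed.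

Section AnyRing.

Variables (R : comUnitRingType) (n : nat).
Variable rM : mx_representation R [set: semidirect As] n.

Lemma repr_sd_elt1 i : rM (sd_elt As 1%g i) = rM (sd_elt As 1%g 1) ^+ i.
Proof.
rewrite sd_elt1X; elim: i => [|i IHi]; first by rewrite expg0 repr_mx1 expr0.
by rewrite expgS repr_mxM ?inE // IHi exprS.
Qed.

Lemma repr_sd_elt_order : rM (sd_elt As 1%g 1) ^+ #[s]%g = 1.
Proof.
by rewrite -repr_sd_elt1 /sd_elt expg_order !morph1 mulg1 repr_mx1.
Qed.

Lemma repr_sd_elt g :
  g \in H -> rM (sd_elt As g 1) = res_fixed rM g *m rM (sd_elt As 1%g 1).
Proof. by move=> Hg; rewrite sd_eltE repr_mxM ?inE. Qed.

End AnyRing.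

(** On the kernel of one of 1 - sigma and N the idempotent has rank at least rank E minus the rank
    of its product with that operator. Passing to the quotient by the image of the other operator
    costs at most the rank of the other product, so the bound is the same for both values of [a]. *)
Lemma Tate_lower_bound (F : fieldType) n
    (rM : mx_representation F [set: semidirect As] n) (e : gT -> F) (a : 'Z_2) :
  let E := gact e (res_fixed rM) in let S := rM (sd_elt As 1%g 1) in
  E *m E = E ->
  (\rank E <= \rank (gact e (Tate rM a)) + \rank (E *m (1%:M - S))%R
              + \rank (E *m \sum_(i < #[s]%g) S ^+ i)%R)%N.
Proof.
move=> E S idE.
have commE X : centgmx (res_fixed rM) X -> E *m X = X *m E.
  by move=> /centgmxP cX; rewrite [RHS]gact_commr.
have norm_eq : norm_sigma rM = \sum_(i < #[s]%g) S ^+ i.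
  by apply: eq_bigr => i _; rewrite repr_sd_elt1.
rewrite -norm_eq -/(sigma_mx rM) -/(one_minus_sigma rM).
have comm1 := commE _ (one_minus_sigma_cent rM).
have commN := commE _ (norm_sigma_cent rM).
rewrite /Tate; case: ifP => _ /=.
  apply: leq_trans (mxrank_idem_ker (one_minus_sigma rM) idE) _.
  rewrite -addnA addnCA leq_add2l commN.
  exact: mxrank_gact_section_lower idE.
apply: leq_trans (mxrank_idem_ker (norm_sigma rM) idE) _.
rewrite addnC leq_add2r comm1.
exact: mxrank_gact_section_lower idE.
Qed.

End SemidirectElements.

Theorem theorem1p4p1
    (l : nat) (l_pr : prime l)
    (Qlbar : closedFieldType) (incl : {rmorphism Ql l_pr -> Qlbar})
    (Qlbar_alg : forall x : Qlbar, algebraicOver incl x)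
    (Flbar : closedFieldType) (Flbar_char : l \in [pchar Flbar])
    (Flbar_alg : forall y : Flbar,
       algebraicOver (fun u : 'F_l => (u : nat)%:R : Flbar) y)
    (red : {rmorphism Zlbar incl -> Flbar})
    (red_surj : forall y : Flbar, exists x : Zlbar incl, red x = y)
    (gT : finGroupType) (G : {group gT})
    (s : {perm gT}) (As : s \in Aut G) (os : #[s]%g = l)
    (n : nat) (V : mx_representation (Zlbar incl) [set: semidirect As] n)
    (V_Qlunr : defined_over (Qlunr incl) (res_G (map_repr val V)))
    (I : finType) (A : I -> representation Flbar (fixed_subgroup G s))
    (m : I -> int)
    (A_irr : forall i, mx_irreducible (A i))
    (A_noniso : forall i j, mx_rsim (A i) (A j) -> i = j)
    (A_red : reduces_to red
       (fun g => \tr (map_repr val V (sd_elt As g 1))) A m)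
    (a : 'Z_2) :
  isom_subrep (virtual_abs A m)
    (semisimplification (Tate (map_repr red V) a)).
Proof.
apply: embeds_isom_subrep; apply: embeds_sum_muln => // i.
rewrite -[X in (_ <= X)%N]/(composition_mult (Tate (map_repr red V) a) (A i)).
have [d [c [r [L [phiE multE]]]]] := A_red.
pose H := fixed_subgroup G s; pose VH := res_fixed V.
pose r' o := if o is Some j then r j else n.
(* [None] stands for [V] itself, so that a single lifted idempotent serves [V] and all the lattices
   [L j]. *)
pose L' o : mx_representation (Zlbar incl) H (r' o) :=
  if o is Some j then L j else VH.
have [e eP] := mult_idempotent Flbar_char (n + \sum_j r j) (A_irr i).
have le_r o : (r' o <= n + \sum_j r j)%N.
  case: o => [j|] /=; last exact: leq_addr.
  by rewrite (bigD1 j) //= addnCA leq_addr.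
have le_T : (rdegree (Tate (map_repr red V) a) <= n + \sum_j r j)%N.
  apply: leq_trans (leq_addr _ _); rewrite /Tate; case: ifP => _ /=.
    exact: leq_trans (rank_leq_row _) (rank_leq_row _).
  exact: leq_trans (rank_leq_row _) (rank_leq_row _).
have val_injO : injective (val : Zlbar incl -> Qlbar) by apply: val_inj.
have [b [f bfP]] := lift_idempotent val_injO red_surj (@Zlbar_closed _ _ _ incl)
   (L := L') (fun o => proj1 (eP _ (map_repr red (L' o)) (le_r o))).
have /= [redb idf eq_fb rank_fe] := bfP None.
set S := V (sd_elt As 1%g 1).
have Sl : S ^+ l = 1 by have := repr_sd_elt_order V; rewrite os.
have comm_S x : x \in H -> map_mx val S *m map_repr val VH x
                           = map_repr val VH x *m map_mx val S.
  move=> Hx; exact: (sd_elt_fixed_comm (map_repr val V) 1 Hx).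
(* Integrating [f] against the character identity replaces the trace on [V] by traces of [f] on the
   [L j]; these are ranks of idempotents, hence multiplicities of [A i]. *)
have tr_fS : \tr (gact f (map_repr val VH) *m map_mx val S) = (m i)%:~R.
  transitivity (\sum_j c j * (composition_mult (map_repr red (L j)) (A i))%:R).
    rewrite gact_trace.
    rewrite (eq_bigr (fun x => \sum_j c j * (f x * \tr (map_repr val (L j) x)))).
      rewrite exchange_big /=; apply: eq_bigr => j _.
      have /= [_ idfj _ rank_fej] := bfP (Some j).
      have [_ <-] := eP _ (map_repr red (L j)) (le_r (Some j)).
      rewrite -rank_fej -(mxtrace_idem idfj) -mulr_sumr.
      by rewrite -[gact _ _ in RHS]mulmx1 gact_trace; under [in RHS]eq_bigr do rewrite mulmx1.
    move=> x Hx; rewrite -map_mxM -repr_sd_elt // phiE // mulr_sumr.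
    by apply: eq_bigr => j _; rewrite mulrCA.
  rewrite multE // (bigD1 i) /=; last by apply/asboolP/mx_rsim_refl.
  rewrite big1 ?addr0 // => j /andP[/asboolP simj] /eqP[].
  exact: A_noniso.
have [idT <-] := eP _ (Tate (map_repr red V) a) le_T.
have := tate_bound l_pr val_injO red_surj (@Zlbar_closed _ _ _ incl)
  (Ql_extension_char0 incl) Flbar_char Sl idf (esym (gact_commr _ comm_S)) eq_fb.
rewrite redb => /(_ _ rank_fe tr_fS).
have idE := proj1 (eP _ (map_repr red VH) (le_r None)).
have := Tate_lower_bound (rM := map_repr red V) a idE; rewrite os.
have squeeze (x t u v y : nat) :
  (x <= t + u + v)%N -> (u + v + y <= x)%N -> (y <= t)%N by lia.
exact: squeeze.
Qed.
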